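(* Let $H\in(0,1)$, let $B^H$ be a fractional Brownian motion with Hurst index $H$, and let $u>0$ be fixed. Then the conditional process $\hat B^H(u)=(\hat B^H_t(u))_{t\ge u}$ and the conditional mean $\hat m^H(u)=(\hat m^H_t(u))_{t\ge u}$ both have Hölder index $H$.
   Context: Fractional Brownian motion $B^H$ with Hurst index $H\in(0,1)$ is the centered Gaussian process on $[0,\infty)$ with covariance $r_H(t,s)=\frac12\left[t^{2H}+s^{2H}-|t-s|^{2H}\right]$. For $0<v<t$ let $$k_H(t,v)=d_H\left[\left(\tfrac{t}{v}\right)^{H-\frac12}(t-v)^{H-\frac12}-\left(H-\tfrac12\right)v^{\frac12-H}\int_v^t z^{H-\frac32}(z-v)^{H-\frac12}\,\mathrm{d}z\right],\qquad d_H=\sqrt{\frac{2H\,\Gamma(\frac32-H)}{\Gamma(H+\frac12)\Gamma(2-2H)}}.$$ It is a known fact that $B^H_t=\int_0^t k_H(t,v)\,\mathrm{d}W_v$ for a Brownian motion $W$ generating the same filtration as $B^H$. Let $\mathcal{F}_u=\sigma(B^H_v:v\le u)$. The conditional mean is $\hat m^H_t(u)=\mathbb{E}[B^H_t\,|\,\mathcal{F}_u]=\int_0^u k_H(t,v)\,\mathrm{d}W_v$ for $t\ge u$. The conditional process $\hat B^H(u)$ is $(B^H_t)_{t\ge u}$ under its regular conditional law given $\mathcal{F}_u$: it is Gaussian with ($\mathcal{F}_u$-measurable) mean function $\hat m^H_t(u)$ and deterministic covariance function $\hat r_H(t,s|u)=r_H(t,s)-\int_0^u k_H(t,v)k_H(s,v)\,\mathrm{d}v$,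 $t,s\ge u$. A process $X$ is Hölder continuous of order $\gamma$ if for all $T>0$ there exists an almost surely finite random variable $C_T$ such that $|X_t-X_s|\le C_T|t-s|^\gamma$ for all $t,s\le T$ in the index set (here $[u,\infty)$). The Hölder index of the process is the supremum of all $\gamma$ for which this holds. As usual, processes are considered up to continuous modification.
   Formalization: The claim on the conditional mean is stated for H ≠ 1/2 only: for H = 1/2 the conditional mean is W_u, constant in t ≥ u, hence Hölder continuous of every order, so its index is not H. The claim on the conditional process covers all H in (0,1). *)

(* Defs.v *)
From HB Require Import structures.
From mathcomp Require Import all_boot all_order all_algebra.
From mathcomp Require Import all_classical all_reals all_analysis.
From mathcomp Require Import measurable_realfun.

Set Implicit Arguments.
Unset Strict Implicit.
Unset Printing Implicit Defensive.

Import Order.TTheory GRing.Theory Num.Theory.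
Import numFieldNormedType.Exports.

Local Open Scope classical_set_scope.
Local Open Scope ring_scope.

(** ** Fractional Brownian motion *)

(* Degenerate Gaussians are treated apart: the library sets [normal_prob m 0]
   to the uniform law on [[0, 1]], not to the point mass at [m]. *)
Definition gaussian_rv d (T : measurableType d) (R : realType)
    (P : probability T R) (X : T -> R) : Prop :=
  measurable_fun setT X /\
  ((exists m s : R, 0 < s /\
      forall A : set R, measurable A -> P (X @^-1` A) = normal_prob m s A) \/
   (exists m : R, {ae P, forall w, X w = m})).

Definition gaussian_process d (T : measurableType d) (R : realType)
    (P : probability T R) (D : set R) (X : R -> T -> R) : Prop :=
  forall (n : nat) (a t : 'I_n -> R), (forall i, D (t i)) ->
    gaussian_rv P (fun w => \sum_(i < n) a i * X (t i) w).

Definition fBm_cov (R : realType) (H t s : R) : R :=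
  2^-1 * (t `^ (2 * H) + s `^ (2 * H) - `|t - s| `^ (2 * H)).

(* The time set is [[0, +oo)]: the values of [B] at negative times are junk. *)
Definition is_fBm d (T : measurableType d) (R : realType)
    (P : probability T R) (H : R) (B : R -> {RV P >-> R}) : Prop :=
  [/\ gaussian_process P `[0, +oo[ (fun t => B t : T -> R),
      (forall t, 0 <= t -> ('E_P[B t] = 0)%E)
    & (forall t s, 0 <= t -> 0 <= s ->
        covariance P (B t) (B s) = (fBm_cov H t s)%:E)].

Definition past d (T : measurableType d) (R : realType) (X : R -> T -> R)
    (u : R) : set (set T) :=
  <<s \bigcup_(v in `[0, u]) preimage_set_system setT (X v) measurable >>.

(** ** Hoelder index, up to continuous modification *)

(* The paths that violate the bound are those where [C w = +oo]. *)
Definition holder_process d (T : measurableType d) (R : realType)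
    (P : probability T R) (D : set R) (X : R -> T -> R) (gamma : R) : Prop :=
  forall b : R, 0 < b -> exists C : T -> \bar R,
    [/\ measurable_fun setT C,
        {ae P, forall w, C w \is a fin_num}
      & forall w s t, D s -> D t -> s <= b -> t <= b ->
          (`|X t w - X s w|%:E <= C w * (`|t - s| `^ gamma)%:E)%E].

Definition holder_index d (T : measurableType d) (R : realType)
    (P : probability T R) (D : set R) (X : R -> T -> R) : \bar R :=
  ereal_sup [set gamma%:E | gamma in
    [set gamma : R | 0 < gamma /\ holder_process P D X gamma]].

Definition modification d (T : measurableType d) (R : realType)
    (P : probability T R) (D : set R) (X Y : R -> T -> R) : Prop :=
  forall t, D t -> {ae P, forall w, Y t w = X t w}.

Definition continuous_modification d (T : measurableType d) (R : realType)
    (P : probability T R) (D : set R) (X Y : R -> T -> R) : Prop :=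
  [/\ forall t, D t -> measurable_fun setT (Y t),
      modification P D X Y
    & {ae P, forall w, {within D, continuous (Y ^~ w)}}].

Definition has_holder_index d (T : measurableType d) (R : realType)
    (P : probability T R) (D : set R) (X : R -> T -> R) (l : R) : Prop :=
  (exists Y, continuous_modification P D X Y) /\
  (forall Y, continuous_modification P D X Y -> holder_index P D Y = l%:E).

(** ** Conditioning on a sub-sigma-algebra [G] *)

Definition is_cond_expectation d (T : measurableType d) (R : realType)
    (P : probability T R) (G : set (set T)) (X Z : T -> R) : Prop :=
  [/\ forall A : set R, measurable A -> G (Z @^-1` A),
      P.-integrable setT (EFin \o Z)
    & forall A : set T, G A ->
        (\int[P]_(w in A) (Z w)%:E = \int[P]_(w in A) (X w)%:E)%E].

Definition is_regular_cond_law d (T : measurableType d) (R : realType)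
    (P : probability T R) (G : set (set T))
    d' (E : measurableType d') (Y : T -> E) (kappa : T -> probability E R)
    : Prop :=
  forall A : set E, measurable A ->
    is_cond_expectation P G (\1_(Y @^-1` A)) (fun w => fine (kappa w A)).

(** ** The space of paths that are continuous on [[u, +oo)] *)

(* Values at times before [u] are junk; the sigma-algebra does not see them. *)
Record cpath (R : realType) (u : R) := CPath {
  cpath_fun :> R -> R ;
  cpath_continuous : {within `[u, +oo[, continuous cpath_fun} }.

Lemma cst_within_continuous (R : realType) (u : R) :
  {within `[u, +oo[, continuous (fun _ : R => 0 : R)}.
Proof. by apply: continuous_subspaceT => x; exact: cvg_cst. Qed.

HB.instance Definition _ (R : realType) (u : R) := gen_eqMixin (cpath u).
HB.instance Definition _ (R : realType) (u : R) := gen_choiceMixin (cpath u).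
HB.instance Definition _ (R : realType) (u : R) :=
  isPointed.Build (cpath u) (CPath (@cst_within_continuous R u)).

Definition cpath_cylinders (R : realType) (u : R) : set (set (cpath u)) :=
  \bigcup_(t in `[u, +oo[)
    preimage_set_system setT (fun f : cpath u => f t) measurable.

HB.instance Definition _ (R : realType) (u : R) :=
  Measurable.copy (cpath u) (g_sigma_algebraType (@cpath_cylinders R u)).

Definition coordinate (R : realType) (u : R) (t : R) (f : cpath u) : R := f t.

(** ** The conditional process and the conditional mean *)

(* [Y] is the continuous modification of [(B t)_(t >= u)]; for each [w], the
   conditional process is the coordinate process under [kappa w]. *)
Definition is_conditional_process d (T : measurableType d) (R : realType)
    (P : probability T R) (B : R -> T -> R) (u : R)
    (Y : {mfun T >-> cpath u}) (kappa : T -> probability (cpath u) R) : Prop :=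
  modification P `[u, +oo[ B (fun t w => Y w t) /\
  is_regular_cond_law P (past B u) Y kappa.

Definition is_conditional_mean d (T : measurableType d) (R : realType)
    (P : probability T R) (B : R -> T -> R) (u : R) (m : R -> T -> R) : Prop :=
  forall t, u <= t -> is_cond_expectation P (past B u) (B t) (m t).

(* Main.v *)
(* Lower bound.  Write [(x)_c = max 0 (|x| / c - 1)].  Gaussian moments bound
   E [(B_t - B_s)_c] by C_p (|t - s|^H / c)^p for every p, and since [x |-> (x)_c]
   is convex the increments of the conditional mean inherit these bounds.  For
   gamma < H the sum of [(.)_(2^(- n gamma))] over all dyadic increments of level
   n and all n is then almost surely finite, and chaining along dyadic times
   turns it into a gamma-Hoelder constant.  Under the conditional law the
   finiteness of this sum is an event of probability one, hence it has conditional
   probability one for almost all w.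

   Upper bound.  The path of B is not gamma-Hoelder at u for gamma > H because
   the laws of (B_(u+h) - B_u) / h^H coincide and have no atom at 0; again this
   passes to the conditional law.  For the conditional mean, let X, Z be the
   increments of B and of the mean over [u, u+h] and let xi = B_u - B_(u-h), which
   is known at time u.  Its correlation rho with X is non-zero when H <> 1/2, and
   E [X sign xi] = E [Z sign xi] is of exact order h^H, which is impossible if
   |Z| <= K h^gamma outside an event of small probability. *)
Require Import Defs.
From HB Require Import structures.
From mathcomp Require Import all_boot all_order all_algebra.
From mathcomp Require Import all_classical all_reals all_analysis.
From mathcomp Require Import measurable_realfun.
From mathcomp Require Import ring lra zify.
Set Implicit Arguments.
Unset Strict Implicit.
Unset Printing Implicit Defensive.
Import Order.TTheory GRing.Theory Num.Theory.
Import numFieldNormedType.Exports.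
Local Open Scope classical_set_scope.
Local Open Scope ring_scope.

(** * Gaussian variables *)

(** Two obstacles shape the proof. The conditional mean is accessible only through its integrals
    over events of the past. Hence the choice of (x)_c: up to a factor it is a sum of two positive
    parts, and Jensen for (x - c)^+ amounts to testing the mean on the single event where it exceeds
    c. Likewise the upper bound tests against sign xi, because a sign merely splits a past event
    into two past events. The second obstacle is that Hölder continuity concerns uncountably many
    times, while the index must be the same for every continuous modification, and under the
    conditional law for almost all w and all exponents at once. Both bounds are therefore carried by
    functionals of the values at the countably many times u + k / 2^n: these are measurable on path
    space and almost surely unchanged under modification. The Gaussian input is that centred
    Gaussian variables of variance 1 share one law, so that scaling gives all moments of
    increments. *)

Lemma ge0_integral_normal_prob (R : realType) (m s : R) (f : R -> \bar R) :
  measurable_fun setT f -> (forall x, 0 <= f x)%E ->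
  (\int[normal_prob m s]_x f x =
   \int[lebesgue_measure]_x (f x * (normal_pdf m s x)%:E))%E.
Proof.
move=> mf f0.
have dom := @normal_prob_dominates R m s.
rewrite -(Radon_Nikodym_SigmaFinite.change_of_variables dom)//.
have fi := Radon_Nikodym_SigmaFinite.f_integrable dom.
have mpdf : measurable_fun setT (EFin \o normal_pdf m s).
  by apply/measurable_EFinP; exact: measurable_normal_pdf.
apply: ae_eq_integral => //.
- by apply: emeasurable_funM => //; exact: measurable_int fi.
- by apply: emeasurable_funM.
(* The Radon-Nikodym derivative and [normal_pdf] have the same integral over every measurable set,
   hence agree almost everywhere. *)
- apply: ae_eqe_mul2l => /=.
  apply: integral_ae_eq => //= E _ mE.
  by rewrite -(Radon_Nikodym_SigmaFinite.f_integral dom).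
Qed.

(** Completing the square: tilting the density by exp (a x) shifts the mean to m + a s^2 and
    multiplies the total mass by the constant on the right. *)
Lemma ge0_integral_expR_normal (R : realType) (a m s : R) : 0 < s ->
  (\int[normal_prob m s]_x (expR (a * x))%:E =
   (expR (a * m + a ^+ 2 * s ^+ 2 / 2))%:E)%E.
Proof.
move=> s0; have sN0 : s != 0 by rewrite gt_eqF.
have me : measurable_fun setT (fun x : R => (expR (a * x))%:E).
  by apply/measurable_EFinP; apply: measurableT_comp => //; exact: measurable_funM.
rewrite ge0_integral_normal_prob//.
under eq_integral => x _.
  rewrite -EFinM (_ : expR _ * _ = expR (a * m + a ^+ 2 * s ^+ 2 / 2) *
      normal_pdf (m + a * s ^+ 2) s x); last first.
    rewrite !normal_pdfE//= [LHS]mulrCA [RHS]mulrCA; congr (_ * _).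
    rewrite /normal_fun.  rewrite -!expRD; congr expR.
    by field.
  rewrite EFinM.
  over.
rewrite ge0_integralZl_EFin ?expR_ge0//.
- by rewrite integral_normal_pdf mule1.
- by move=> x _; rewrite lee_fin normal_pdf_ge0.
- by apply/measurable_EFinP; exact: measurable_normal_pdf.
Qed.

(** Substitution y = x / s. With f = x^2 it makes the second moment proportional to s^2, so that the
    variance determines s. *)
Lemma ge0_integral_normal_scale (R : realType) (s : R) (f : R -> R) : 0 < s ->
  continuous f -> (forall x, 0 <= f x) ->
  (\int[normal_prob 0 s]_x (f x)%:E = \int[normal_prob 0 1]_x (f (s * x))%:E)%E.
Proof.
move=> s0 cf f0; have sN0 : s != 0 by rewrite gt_eqF.
have cfs : continuous (fun x => f (s * x)).
  move=> x; apply: (@continuous_comp _ _ _ (fun x => s * x) f); last exact: cf.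
  by apply: cvgMr; exact: cvg_id.
have mE (g : R -> R) : continuous g -> measurable_fun setT (fun x => (g x)%:E).
  by move=> cg; apply/measurable_EFinP; exact: continuous_measurable_fun.
rewrite [LHS]ge0_integral_normal_prob; last 2 first.
- exact: mE.
- by move=> x; rewrite lee_fin.
rewrite [RHS]ge0_integral_normal_prob; last 2 first.
- exact: mE.
- by move=> x; rewrite lee_fin.
pose F (x : R^o) : R^o := x / s.
have dF (x : R) : derivable F x 1.
  apply: (@derivableM _ _ (@id R^o) (@cst R^o R^o s^-1)).
    exact: derivable_id.
  exact: derivable_cst.
have F'E : F^`()%classic = cst s^-1.
  apply/funext => x; rewrite /F derive1E deriveM// derive_cst scaler0.
  by rewrite add0r derive_id scaler1.
pose G (y : R) := f (s * y) * normal_pdf 0 1 y.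
transitivity (\int[lebesgue_measure]_x (G x)%:E)%E; last first.
  by apply: eq_integral => x _; rewrite /G EFinM.
have G0 (x : R) : 0 <= G x by rewrite mulr_ge0// normal_pdf_ge0.
have cG : continuous G.
  move=> x; apply: cvgM; first exact: cfs.
  by apply: continuous_normal_pdf; rewrite oner_eq0.
have Fy : F x @[x --> +oo] --> +oo.
  by apply/gt0_cvgMly; [rewrite invr_gt0|exact: cvg_id].
have FNy : F x @[x --> -oo] --> -oo.
  by apply/gt0_cvgMlNy; [rewrite invr_gt0|exact: cvg_id].
have incF : {homo F : x y / x < y}.
  by move=> x y xy; rewrite /F ltr_pM2r// invr_gt0.
have cF' : continuous F^`()%classic by rewrite F'E => ?; exact: cvg_cst.
have cvgF'Ny : cvg (F^`()%classic x @[x --> -oo]) by rewrite F'E; exact: is_cvg_cst.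
have cvgF'y : cvg (F^`()%classic x @[x --> +oo]) by rewrite F'E; exact: is_cvg_cst.
rewrite (increasing_ge0_integration_by_substitutionT
  incF cF' cvgF'Ny cvgF'y dF FNy Fy cG G0).
apply: eq_integral => x _; rewrite -EFinM; congr EFin.
rewrite F'E /= /G /F mulrfctE /= [s * _]mulrCA divff// mulr1 -mulrA; congr (_ * _).
rewrite !normal_pdfE ?oner_eq0//= /normal_peak /normal_fun !subr0 [RHS]mulrAC.
congr (_ * _); last first.
  by congr expR; field; rewrite sN0.
rewrite -invfM; congr (_^-1).
rewrite expr1n mul1r -!mulrnAr sqrtrM ?sqr_ge0// sqrtr_sqr gtr0_norm//.
by rewrite mulrC.
Qed.

(** The Taylor term |x|^n / n! is below exp |x|; this turns the explicit Laplace transform into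
    finiteness of all moments. *)
Lemma normr_exp_le_expR (R : realType) (n : nat) (x : R) :
  `|x| ^+ n <= n`!%:R * (expR x + expR (- x)).
Proof.
have : `|x| ^+ n <= n`!%:R * expR `|x|.
  case: n => [|n]; first by rewrite expr0 mul1r -expR0 ler_expR.
  rewrite mulrC -ler_pdivrMr ?ltr0n ?fact_gt0//.
  by have := expR_ge1Dxn n (normr_ge0 x); lra.
move=> /le_trans; apply; rewrite ler_wpM2l//.
have := expR_ge0 x; have := expR_ge0 (- x).
by have [x0|x0] := leP 0 x; rewrite ?(ger0_norm x0) ?(ltr0_norm x0); lra.
Qed.

Lemma integral_normr_exp_normal_lty (R : realType) (m s : R) (n : nat) : 0 < s ->
  (\int[normal_prob m s]_x (`|x| ^+ n)%:E < +oo)%E.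
Proof.
move=> s0.
have mE (a : R) : measurable_fun setT (fun x : R => (expR (a * x))%:E).
  by apply/measurable_EFinP; apply: measurableT_comp => //; exact: measurable_funM.
apply: (@le_lt_trans _ _ (\int[normal_prob m s]_x
    ((n`!%:R)%:E * ((expR (1 * x))%:E + (expR (-1 * x))%:E)))%E).
  apply: ge0_le_integral => //.
  - apply/measurable_EFinP; apply: measurable_funX; exact: normr_measurable.
  - by apply: measurable_funeM; apply: emeasurable_funD; exact: mE.
  - move=> x _; rewrite -EFinD -EFinM lee_fin mul1r mulN1r.
    exact: normr_exp_le_expR.
rewrite ge0_integralZl_EFin//; last 2 first.
- by move=> x _; rewrite adde_ge0.
- by apply: emeasurable_funD; exact: mE.
rewrite ge0_integralD//; [|exact: mE|exact: mE].
by rewrite !ge0_integral_expR_normal// -EFinD -EFinM ltry.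
Qed.

Lemma integral_cst_probability d (T : measurableType d) (R : realType) (P : probability T R)
    (c : R) : (\int[P]_w c%:E = c%:E)%E.
Proof.
rewrite integral_cst// [X in (_ * X)%E](_ : _ = 1%E) ?mule1//.
exact: (probability_setT P).
Qed.

Lemma ge0_integral_normal_law d (T : measurableType d) (R : realType) (P : probability T R)
    (X : T -> R) (m s : R) (f : R -> R) :
  measurable_fun setT X -> (forall A, measurable A -> P (X @^-1` A) = normal_prob m s A) ->
  measurable_fun setT f -> (forall x, 0 <= f x) ->
  (\int[P]_w (f (X w))%:E = \int[normal_prob m s]_x (f x)%:E)%E.
Proof.
move=> mX law mf f0.
pose X' : {mfun T >-> measurableTypeR R} :=
  HB.pack (X : T -> measurableTypeR R)
    (@isMeasurableFun.Build _ _ _ (measurableTypeR R) (X : T -> measurableTypeR R) mX).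
have mf' : measurable_fun [set: measurableTypeR R] (EFin \o f).
  by apply/measurable_EFinP.
have f0' y : (0 <= (EFin \o f) y)%E by rewrite lee_fin.
have <- := @ge0_integral_distribution _ _ T (measurableTypeR R) _ P X'
  (EFin \o f) mf' f0'.
apply: (@eq_measure_integral _ (measurableTypeR R) R setT (normal_prob m s)
  (distribution P X') (EFin \o f)) => A mA _; exact: law.
Qed.

Lemma ae_cst_integrable d (T : measurableType d) (R : realType) (P : probability T R)
    (X : T -> R) (c : R) : measurable_fun setT X -> {ae P, forall w, X w = c} ->
  P.-integrable setT (EFin \o X) /\ (\int[P]_w (X w)%:E = c%:E)%E.
Proof.
move=> mX aeX.
have mX' : measurable_fun setT (EFin \o X) by apply/measurable_EFinP.
have aeN : ae_eq P setT (abse \o EFin \o X) (cst `|c|%:E).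
  by apply: filterS aeX => w Xw _ /=; rewrite Xw.
split.
  apply/integrableP; split => //.
  rewrite (ae_eq_integral (cst `|c|%:E))//; last exact: measurableT_comp.
  by rewrite integral_cst_probability ltry.
rewrite (ae_eq_integral (cst c%:E))//.
  exact: integral_cst_probability.
by apply: filterS aeX => w Xw _ /=; rewrite Xw.
Qed.

Lemma gaussian_rv_integrable_exp d (T : measurableType d) (R : realType)
    (P : probability T R) (X : T -> R) (n : nat) :
  gaussian_rv P X -> P.-integrable setT (fun w => (`|X w| ^+ n)%:E).
Proof.
case=> mX lawX.
have mXn : measurable_fun setT (fun w => `|X w| ^+ n).
  by apply: measurable_funX; exact: measurableT_comp.
case: lawX => [[m [s [s0 lawX]]]|[m aeX]]; last first.
  have aeXn : {ae P, forall w, `|X w| ^+ n = `|m| ^+ n} by apply: filterS aeX => w ->.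
  by have [] := ae_cst_integrable mXn aeXn.
apply/integrableP; split; first exact/measurable_EFinP.
under eq_integral do rewrite gee0_abs ?lee_fin ?exprn_ge0//.
rewrite (@ge0_integral_normal_law _ _ _ P X m s (fun x => `|x| ^+ n))//.
  exact: integral_normr_exp_normal_lty.
by apply: measurable_funX; exact: normr_measurable.
Qed.

Lemma gaussian_rv_integrable d (T : measurableType d) (R : realType)
    (P : probability T R) (X : T -> R) :
  gaussian_rv P X -> P.-integrable setT (EFin \o X).
Proof.
move=> GX; have [mX _] := GX.
have := @gaussian_rv_integrable_exp _ _ _ _ _ 1 GX; apply: le_integrable => //.
  exact/measurable_EFinP.
by move=> w _ /=; rewrite lee_fin expr1 normr_id.
Qed.

(* The second moment of [normal_prob 0 1] is left unevaluated: it only matters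
   that all centred Gaussian variables of variance 1 have the same law. *)
Definition unit_normal_sd (R : realType) : R :=
  (Num.sqrt (fine (\int[normal_prob 0 1]_x ((x : R) ^+ 2)%:E)))^-1.

(** In [gaussian_rv] the numbers m and s only label a law; they have to be recovered from the
    moments. Variance 1 excludes the degenerate case, Jensen applied to exponentials gives m = 0,
    and scaling of the second moment gives s. *)
Lemma standardized_gaussian_law d (T : measurableType d) (R : realType)
    (P : probability T R) (X : T -> R) :
  gaussian_rv P X -> (\int[P]_w (X w)%:E = 0)%E ->
  (\int[P]_w (X w ^+ 2)%:E = 1)%E ->
  0 < unit_normal_sd R /\
  forall A, measurable A -> P (X @^-1` A) = normal_prob 0 (unit_normal_sd R) A.
Proof.
move=> GX EX0 EX21.
have iX := gaussian_rv_integrable GX.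
case: GX => mX [[m [s [s0 lawX]]]|[m aeX]]; last first.
  have [_] := ae_cst_integrable mX aeX; rewrite EX0 => -[m0].
  have mX2 : measurable_fun setT (fun w => X w ^+ 2) by exact: measurable_funX.
  have aeX2 : {ae P, forall w, X w ^+ 2 = 0}.
    by apply: filterS aeX => w ->; rewrite -m0 expr0n.
  have [_] := ae_cst_integrable mX2 aeX2.
  by rewrite EX21 => -[] /eqP; rewrite oner_eq0.
have m0 : m = 0.
  (* Jensen: E exp (a X) >= 1 + a E X = 1 for all a. *)
  have key (a : R) : 0 <= a * m + a ^+ 2 * s ^+ 2 / 2.
    have : ((1 : R)%:E <= (expR (a * m + a ^+ 2 * s ^+ 2 / 2))%:E)%E.
      rewrite -ge0_integral_expR_normal//.
      have mexp : measurable_fun setT (fun x : R => expR (a * x)).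
        by apply: measurableT_comp => //; exact: measurable_funM.
      rewrite -(@ge0_integral_normal_law _ _ _ P X m s (fun x => expR (a * x)))//.
      have iaX : P.-integrable setT (fun w => (1 + a * X w)%:E).
        rewrite (_ : (fun _ => _) = (cst 1%:E \+ (fun w => a%:E * (X w)%:E))%E)//.
        apply: integrableD => //; first exact: finite_measure_integrable_cst.
        exact: integrableZl.
      have -> : (1%:E = \int[P]_w (1 + a * X w)%:E)%E.
        under eq_integral do rewrite EFinD EFinM.
        rewrite integralD//; last 2 first.
        - exact: finite_measure_integrable_cst.
        - exact: integrableZl.
        rewrite integralZl// EX0 mule0 adde0.
        by rewrite integral_cst_probability.
      apply: le_integral => //.
      + apply/integrableP; split; first by apply/measurable_EFinP; exact: (measurableT_comp mexp).
        under eq_integral do rewrite gee0_abs ?lee_fin ?expR_ge0//.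
        rewrite (@ge0_integral_normal_law _ _ _ P X m s (fun x => expR (a * x)))//.
        by rewrite ge0_integral_expR_normal// ltry.
      + by move=> w _; rewrite lee_fin expR_ge1Dx.
    by rewrite lee_fin -[leLHS]expR0 ler_expR.
  (* This a minimises the quadratic in [key]; the minimum is - (m / s)^2 / 2, so it can be
     nonnegative only for m = 0. *)
  have := key (- m / s ^+ 2).
  rewrite (_ : _ + _ = - ((m / s) ^+ 2 / 2)); last by field; rewrite gt_eqF.
  rewrite oppr_ge0 pmulr_lle0// => m20.
  have /eqP : (m / s) ^+ 2 = 0 by apply/eqP; rewrite eq_le m20 sqr_ge0.
  by rewrite sqrf_eq0 mulf_eq0 invr_eq0 (gt_eqF s0) orbF => /eqP.
move: lawX; rewrite {}m0 => lawX.
suff -> : unit_normal_sd R = s by [].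
have mx2 : measurable_fun setT (fun x : R => x ^+ 2) by exact: measurable_funX.
have := EX21.
rewrite (@ge0_integral_normal_law _ _ _ P X 0 s (fun x => x ^+ 2))//; last first.
  by move=> x; exact: sqr_ge0.
rewrite ge0_integral_normal_scale//; last 2 first.
- exact: exprn_continuous.
- by move=> x; exact: sqr_ge0.
under eq_integral do rewrite exprMn EFinM.
rewrite ge0_integralZl_EFin//; last 3 first.
- by move=> x _; rewrite lee_fin sqr_ge0.
- exact/measurable_EFinP.
- exact: sqr_ge0.
rewrite /unit_normal_sd.
have : (0 <= \int[normal_prob 0 1]_x ((x : R) ^+ 2)%:E)%E.
  by apply: integral_ge0 => x _; rewrite lee_fin sqr_ge0.
(* Here 1 = s^2 v, with v the second moment of the standard normal law; v = +oo is impossible, and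
   otherwise s = v^(-1/2). *)
case: (integral _ _ _) => [v| |]//=; last by rewrite gt0_muley ?lte_fin ?exprn_gt0.
rewrite lee_fin => v0 [s2v].
have -> : v = (s^-1) ^+ 2.
  by rewrite exprVn -[LHS]mul1r -(mulVf (x := s ^+ 2)) ?sqrf_eq0 ?gt_eqF// -mulrA s2v mulr1.
by rewrite sqrtr_sqr ger0_norm ?invr_ge0 ?ltW// invrK.
Qed.

(** * Linear combinations and increments of fractional Brownian motion *)

Lemma fBm_integral d (T : measurableType d) (R : realType) (P : probability T R)
    (H : R) (B : R -> {RV P >-> R}) (t : R) : is_fBm H B -> 0 <= t ->
  (\int[P]_w (B t w)%:E = 0)%E.
Proof.
by case=> _ EB _ t0; have := EB _ t0; rewrite unlock.
Qed.

Lemma fBm_integral_mul d (T : measurableType d) (R : realType) (P : probability T R)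
    (H : R) (B : R -> {RV P >-> R}) (s t : R) : is_fBm H B -> 0 <= s -> 0 <= t ->
  (\int[P]_w (B s w * B t w)%:E = (fBm_cov H s t)%:E)%E.
Proof.
case=> _ EB cB s0 t0; rewrite -cB// unlock !EB// unlock /=.
by apply: eq_integral => w _; rewrite mulrfctE /= !subr0.
Qed.

Lemma fBm_gaussian_rv d (T : measurableType d) (R : realType) (P : probability T R)
    (H : R) (B : R -> {RV P >-> R}) (t : R) : is_fBm H B -> 0 <= t ->
  gaussian_rv P (B t).
Proof.
case=> gB _ _ t0.
rewrite (_ : B t = (fun w => \sum_(i < 1) 1 * B t w) :> (T -> R)).
  by apply: (gB 1 (fun=> 1) (fun=> t)) => i; rewrite /= in_itv/= andbT.
by apply/funext => w; rewrite big_ord1 mul1r.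
Qed.

Lemma fBm_integrable_mul d (T : measurableType d) (R : realType) (P : probability T R)
    (H : R) (B : R -> {RV P >-> R}) (s t : R) : is_fBm H B -> 0 <= s -> 0 <= t ->
  P.-integrable setT (fun w => (B s w * B t w)%:E).
Proof.
move=> fB s0 t0.
have i2 r : 0 <= r -> P.-integrable setT (fun w => (`|B r w| ^+ 2)%:E).
  by move=> r0; apply: gaussian_rv_integrable_exp; exact: fBm_gaussian_rv fB r0.
have := integrableD measurableT (i2 _ s0) (i2 _ t0); apply: le_integrable => //.
  by apply/measurable_EFinP; exact: measurable_funM.
move=> w _ /=; rewrite lee_fin [leRHS]ger0_norm ?addr_ge0 ?sqr_ge0// normrM.
have := sqr_ge0 (`|B s w| - `|B t w|); have := sqr_ge0 (`|B s w| + `|B t w|).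
rewrite sqrrD sqrrB; lra.
Qed.

Lemma fBm_combination d (T : measurableType d) (R : realType) (P : probability T R)
    (H : R) (B : R -> {RV P >-> R}) (n : nat) (a t : 'I_n -> R) :
  is_fBm H B -> (forall i, 0 <= t i) ->
  let X w := \sum_(i < n) a i * B (t i) w in
  [/\ gaussian_rv P X, (\int[P]_w (X w)%:E = 0)%E &
    (\int[P]_w (X w ^+ 2)%:E =
      (\sum_(i < n) \sum_(j < n) a i * a j * fBm_cov H (t i) (t j))%:E)%E].
Proof.
move=> fB t0 X.
have iB i : P.-integrable setT (fun w => (B (t i) w)%:E).
  by apply: gaussian_rv_integrable; exact: fBm_gaussian_rv fB (t0 i).
have gX : gaussian_rv P X.
  by case: fB => gB _ _; apply: gB => i; rewrite /= in_itv/= andbT.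
split => //.
  under eq_integral do rewrite /X -sumEFin.
  rewrite integral_sum//; last by move=> i; exact: (integrableZl measurableT (a i) (iB i)).
  rewrite big1// => i _; under eq_integral do rewrite EFinM.
  by rewrite integralZl// (fBm_integral fB)// mule0.
have iBB i j : P.-integrable setT (fun w => (B (t i) w * B (t j) w)%:E).
  exact: fBm_integrable_mul fB _ _.
under eq_integral => w _.
  rewrite expr2 /X mulr_suml -sumEFin.
  under eq_bigr => i _ do rewrite mulr_sumr -sumEFin.
  over.
have iaBB i j : P.-integrable setT
    (fun w => (a i * B (t i) w * (a j * B (t j) w))%:E).
  apply: eq_integrable (integrableZl measurableT (a i * a j) (iBB i j)) => // w _.
  by rewrite -EFinM mulrACA.
rewrite integral_sum//; last by move=> i; apply: integrable_sum.
rewrite -sumEFin; apply: eq_bigr => i _.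
rewrite integral_sum// -sumEFin; apply: eq_bigr => j _.
under eq_integral do rewrite mulrACA EFinM.
by rewrite integralZl// (fBm_integral_mul fB).
Qed.

Lemma fBm_standardized_law d (T : measurableType d) (R : realType) (P : probability T R)
    (H : R) (B : R -> {RV P >-> R}) (n : nat) (a t : 'I_n -> R) (sd : R) :
  is_fBm H B -> (forall i, 0 <= t i) -> 0 < sd ->
  \sum_(i < n) \sum_(j < n) a i * a j * fBm_cov H (t i) (t j) = sd ^+ 2 ->
  let L w := (\sum_(i < n) a i * B (t i) w) / sd in
  [/\ measurable_fun setT L, 0 < unit_normal_sd R &
  forall A, measurable A -> P (L @^-1` A) = normal_prob 0 (unit_normal_sd R) A].
Proof.
move=> fB t0 sd0 vE L.
have LE : L = (fun w => \sum_(i < n) (a i / sd) * B (t i) w).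
  by apply/funext => w; rewrite /L mulr_suml; apply: eq_bigr => i _; rewrite mulrAC.
have [gL L0 L2] := fBm_combination (fun i => a i / sd) fB t0.
rewrite LE; have [mL _] := gL.
have [||pos law] := standardized_gaussian_law gL => //.
rewrite L2; congr EFin.
transitivity (sd ^- 2 * \sum_(i < n) \sum_(j < n) a i * a j * fBm_cov H (t i) (t j)).
  rewrite mulr_sumr; apply: eq_bigr => i _; rewrite mulr_sumr; apply: eq_bigr => j _.
  by field; rewrite gt_eqF.
by rewrite vE mulVf// sqrf_eq0 gt_eqF.
Qed.

Definition unit_normal_moment (R : realType) (n : nat) : R :=
  fine (\int[normal_prob 0 (unit_normal_sd R)]_x (`|x : R| ^+ n)%:E).

Lemma unit_normal_momentE (R : realType) (n : nat) : 0 < unit_normal_sd R ->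
  (\int[normal_prob 0 (unit_normal_sd R)]_x (`|x : R| ^+ n)%:E =
   (unit_normal_moment R n)%:E)%E.
Proof.
move=> sd0; rewrite /unit_normal_moment fineK// ge0_fin_numE.
  exact: integral_normr_exp_normal_lty.
by apply: integral_ge0 => x _; rewrite lee_fin exprn_ge0.
Qed.

Lemma unit_normal_moment_ge0 (R : realType) (n : nat) : 0 <= unit_normal_moment R n.
Proof. by apply: fine_ge0; apply: integral_ge0 => x _; rewrite lee_fin exprn_ge0. Qed.

Lemma normal_prob_set1 (R : realType) (m s x : R) :
  normal_prob m s [set x] = 0%E.
Proof.
have /null_content_dominatesP := @normal_prob_dominates R m s.
by apply; [exact: measurable_set1|exact: lebesgue_measure_set1].
Qed.

(** A vanishing first absolute moment would concentrate the law at 0, but it has no atoms. *)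
Lemma unit_normal_moment1_gt0 (R : realType) : 0 < unit_normal_sd R ->
  0 < unit_normal_moment R 1.
Proof.
move=> sd0; rewrite lt_neqAle unit_normal_moment_ge0 andbT; apply/eqP => m0.
have := unit_normal_momentE 1 sd0; rewrite -m0 => I0.
pose N : probability (measurableTypeR R) R := normal_prob 0 (unit_normal_sd R).
have mid : measurable_fun [set: measurableTypeR R] (@EFin R).
  by apply/measurable_EFinP.
have /(ae_eq_integral_abs N measurableT mid) ae0 : (\int[N]_x `|(x : R)%:E| = 0)%E by exact: I0.
have N0 : N.-negligible [set 0 : measurableTypeR R].
  by apply/negligibleP; [exact: measurable_set1|exact: normal_prob_set1].
have : N.-negligible [set: measurableTypeR R].
  apply: negligibleS (negligibleU ae0 N0) => x _.
  by have [->|/eqP x0] := eqVneq x 0; [right|left => /(_ I)[]].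
move/(measure_negligible measurableT) => NT.
by have := probability_setT N; rewrite [LHS]NT => -[]/esym/eqP; rewrite oner_eq0.
Qed.

Lemma fBm_combination_moment d (T : measurableType d) (R : realType) (P : probability T R)
    (H : R) (B : R -> {RV P >-> R}) (n : nat) (a t : 'I_n -> R) (sd : R) (p : nat) :
  is_fBm H B -> (forall i, 0 <= t i) -> 0 < sd ->
  \sum_(i < n) \sum_(j < n) a i * a j * fBm_cov H (t i) (t j) = sd ^+ 2 ->
  (\int[P]_w (`|\sum_(i < n) a i * B (t i) w| ^+ p)%:E =
   (unit_normal_moment R p * sd ^+ p)%:E)%E.
Proof.
move=> fB t0 sd0 vE.
have [mL s0 law] := fBm_standardized_law fB t0 sd0 vE.
set L := (fun w => _ / sd) in mL law.
transitivity (\int[P]_w ((sd ^+ p)%:E * (`|L w| ^+ p)%:E))%E.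
  apply: eq_integral => w _; rewrite -EFinM -[in sd ^+ p](gtr0_norm sd0) -exprMn -normrM.
  by rewrite /L mulrC divfK ?gt_eqF.
have mLp : measurable_fun setT (fun w => `|L w| ^+ p).
  by apply: measurable_funX; exact: measurableT_comp.
rewrite ge0_integralZl_EFin//; last 2 first.
- exact/measurable_EFinP.
- by rewrite exprn_ge0 ?ltW.
rewrite (@ge0_integral_normal_law _ _ _ P L 0 (unit_normal_sd R) (fun x => `|x| ^+ p))//.
  by rewrite unit_normal_momentE// -EFinM mulrC.
by apply: measurable_funX; exact: normr_measurable.
Qed.

Lemma fBm_covC (R : realType) (H s t : R) : fBm_cov H s t = fBm_cov H t s.
Proof. by rewrite /fBm_cov distrC [s `^ _ + _]addrC. Qed.

Lemma powR_double (R : realType) (H x : R) : 0 <= x -> x `^ (2 * H) = (x `^ H) ^+ 2.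
Proof. by move=> x0; rewrite mulrC powRrM powR_mulrn// powR_ge0. Qed.

Lemma fBm_cov_increment (R : realType) (H s t : R) : 0 < H -> s < t ->
  fBm_cov H t t + fBm_cov H s s - 2 * fBm_cov H t s = ((t - s) `^ H) ^+ 2.
Proof.
move=> H0 st; rewrite -powR_double ?subr_ge0 ?ltW//.
rewrite /fBm_cov !subrr normr0 powR0 ?mulf_neq0 ?gt_eqF//.
by rewrite gtr0_norm ?subr_gt0//; field.
Qed.

Section fBm_increments.
Variables (d : measure_display) (T : measurableType d) (R : realType).
Variables (P : probability T R) (H : R) (B : R -> {RV P >-> R}).
Hypotheses (H_gt0 : 0 < H) (fB : is_fBm H B).

Let coef2 (i : 'I_2) : R := [:: 1; -1]`_i.
Let time2 (t s : R) (i : 'I_2) : R := [:: t; s]`_i.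

Let sum2E (t s : R) w :
  \sum_(i < 2) coef2 i * B (time2 t s i) w = B t w - B s w.
Proof. by rewrite !big_ord_recl big_ord0 /coef2 /time2/= mul1r mulN1r addr0. Qed.

Let time2_ge0 t s : 0 <= s -> s < t -> forall i, 0 <= time2 t s i.
Proof.
move=> s0 st; have t0 := le_trans s0 (ltW st).
by case=> -[|[|//]] ?.
Qed.

Let var2E t s : s < t -> \sum_(i < 2) \sum_(j < 2)
  coef2 i * coef2 j * fBm_cov H (time2 t s i) (time2 t s j) = ((t - s) `^ H) ^+ 2.
Proof.
move=> st; rewrite -fBm_cov_increment// !big_ord_recl !big_ord0 /coef2 /time2/=.
by rewrite (fBm_covC H s t); ring.
Qed.

Lemma fBm_increment_law (s t : R) : 0 <= s -> s < t ->
  let L w := (B t w - B s w) / (t - s) `^ H in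
  [/\ measurable_fun setT L, 0 < unit_normal_sd R &
  forall A, measurable A -> P (L @^-1` A) = normal_prob 0 (unit_normal_sd R) A].
Proof.
move=> s0 st; have sd0 : 0 < (t - s) `^ H by rewrite powR_gt0 ?subr_gt0.
have LE : (fun w => (\sum_(i < 2) coef2 i * B (time2 t s i) w) / (t - s) `^ H) =
    (fun w => (B t w - B s w) / (t - s) `^ H) by apply/funext => w; rewrite sum2E.
by have := fBm_standardized_law fB (time2_ge0 s0 st) sd0 (var2E st); rewrite /= LE.
Qed.

Lemma fBm_increment_moment (p : nat) (s t : R) : 0 <= s -> s < t ->
  (\int[P]_w (`|B t w - B s w| ^+ p)%:E =
   (unit_normal_moment R p * ((t - s) `^ H) ^+ p)%:E)%E.
Proof.
move=> s0 st; have sd0 : 0 < (t - s) `^ H by rewrite powR_gt0 ?subr_gt0.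
rewrite -(fBm_combination_moment p fB (time2_ge0 s0 st) sd0 (var2E st)).
by apply: eq_integral => w _; rewrite sum2E.
Qed.

(* The correlation coefficient of two adjacent increments of equal length. *)
Definition fBm_rho : R := 2 `^ (2 * H) / 2 - 1.

(** (B_u - B_(u-h)) + a (B_(u+h) - B_u), expanded in the three values of B. *)
Let coef3 (a : R) (i : 'I_3) : R := [:: -1; 1 - a; a]`_i.
Let time3 (u h : R) (i : 'I_3) : R := [:: u - h; u; u + h]`_i.

Lemma fBm_adjacent_increments_moment (a u h : R) : 0 < h -> h <= u ->
  0 < 1 + 2 * a * fBm_rho + a ^+ 2 ->
  (\int[P]_w (`|(B u w - B (u - h) w) + a * (B (u + h) w - B u w)|)%:E =
   (unit_normal_moment R 1 *
      (h `^ H * Num.sqrt (1 + 2 * a * fBm_rho + a ^+ 2)))%:E)%E.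
Proof.
move=> h0 hu v0.
have sd0 : 0 < h `^ H * Num.sqrt (1 + 2 * a * fBm_rho + a ^+ 2).
  by rewrite mulr_gt0 ?powR_gt0 ?sqrtr_gt0.
have t0 i : 0 <= time3 u h i.
  by case: i => -[|[|[|//]]] ?; rewrite /time3/=; lra.
have vE : \sum_(i < 3) \sum_(j < 3)
    coef3 a i * coef3 a j * fBm_cov H (time3 u h i) (time3 u h j) =
    (h `^ H * Num.sqrt (1 + 2 * a * fBm_rho + a ^+ 2)) ^+ 2.
  rewrite exprMn sqr_sqrtr ?(ltW v0)// -powR_double ?(ltW h0)//.
  rewrite !big_ord_recl !big_ord0 /coef3 /time3/=.
  rewrite (fBm_covC H (u - h) u) (fBm_covC H (u - h) (u + h)) (fBm_covC H u (u + h)).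
  rewrite /fBm_cov !subrr normr0 powR0 ?mulf_neq0 ?gt_eqF//.
  have -> : u - (u - h) = h by ring.
  have -> : u + h - (u - h) = 2 * h by ring.
  have -> : u + h - u = h by ring.
  rewrite !gtr0_norm ?mulr_gt0// powRM ?(ltW h0)//.
  by rewrite /fBm_rho; field.
rewrite -[h `^ H * _ in RHS]expr1 -(fBm_combination_moment 1 fB t0 sd0 vE).
apply: eq_integral => w _; rewrite expr1 !big_ord_recl big_ord0 /coef3 /time3/=.
by congr (`|_|%:E); ring.
Qed.

Lemma fBm_rho_lt1 : H < 1 -> `|fBm_rho| < 1.
Proof.
move=> H1.
have h1 : 2 `^ H < 2 :> R.
  rewrite -[ltRHS]powRr1// /powR pnatr_eq0/= ltr_expR ltr_pM2r//.
  by rewrite ln_gt0// ltr1n.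
have h2 : 0 < 2 `^ H :> R by rewrite powR_gt0.
have h3 : 0 < 2 `^ (2 * H) :> R by rewrite powR_gt0.
have h4 : 2 `^ (2 * H) < 4 :> R by rewrite powR_double// expr2; nra.
by rewrite ltr_norml /fBm_rho; apply/andP; split; lra.
Qed.

(** The exclusion of H = 1/2 enters here: adjacent increments of Brownian motion are
    uncorrelated. *)
Lemma fBm_rho_neq0 : H <> 2^-1 -> fBm_rho != 0.
Proof.
move=> H2; apply/eqP; rewrite /fBm_rho => h; apply: H2.
have {h} : 2 `^ (2 * H) = 2 `^ 1 :> R by rewrite powRr1//; lra.
rewrite /powR pnatr_eq0/= => /expR_inj /mulIf h.
have : 2 * H = 1 by apply: h; rewrite gt_eqF// ln_gt0// ltr1n.
lra.
Qed.

End fBm_increments.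

(** * Dyadic chaining *)

(** The grid of step 2^-n is anchored at u, so that the approximations of t >= u stay in the index
    set [u, +oo). *)
Definition dyadic_floor (R : realType) (u t : R) (n : nat) : R :=
  u + (Num.truncn ((t - u) * 2 ^+ n))%:R / 2 ^+ n.

Lemma dyadic_floor_itv (R : realType) (u t : R) (n : nat) : u <= t ->
  u <= dyadic_floor u t n <= t /\ t - dyadic_floor u t n <= 2^-1 ^+ n.
Proof.
move=> ut; have p0 : 0 < 2 ^+ n :> R by rewrite exprn_gt0.
have x0 : 0 <= (t - u) * 2 ^+ n by rewrite mulr_ge0 ?subr_ge0// ltW.
have /andP[lo hi] := truncn_itv x0.
rewrite /dyadic_floor; set k := Num.truncn _ in lo hi *.
rewrite lerDl divr_ge0 ?ler0n ?(ltW p0)//= -lerBrDl ler_pdivrMr// lo; split => //.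
rewrite opprD addrA lerBlDr exprVn -[X in _ <= X + _]mul1r -[leRHS]mulrDl ler_pdivlMr//.
by rewrite -natr1 in hi; lra.
Qed.

Lemma cvg_expr_half (R : realType) : (2^-1 : R) ^+ n @[n --> \oo] --> 0.
Proof. by apply: cvg_expr; rewrite gtr0_norm ?invr_gt0// invf_lt1// ltr1n. Qed.

Lemma cvg_dyadic_floor (R : realType) (u t : R) (f : R -> R) :
  {within `[u, +oo[, continuous f} -> u <= t ->
  f (dyadic_floor u t n) @[n --> \oo] --> f t.
Proof.
move=> /subspace_continuousP cf ut.
have tu : `[u, +oo[%classic t by rewrite /= in_itv/= ut.
have d_cvg : dyadic_floor u t n @[n --> \oo] --> t.
  apply/cvgrPdist_le => e e0.
  move/cvgrPdist_le : (@cvg_expr_half R) => /(_ e e0); apply: filterS => n.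
  rewrite sub0r normrN => h.
  have [/andP[_ dt] dist] := dyadic_floor_itv n ut.
  by rewrite ger0_norm ?subr_ge0// (le_trans dist)// (le_trans _ h)// ler_norm.
apply: (cvg_comp (dyadic_floor u t) f _ (cf t tu)) => V /= hV.
have h : \forall n \near \oo, `[u, +oo[%classic (dyadic_floor u t n) ->
  V (dyadic_floor u t n) := d_cvg _ hV.
suff : \forall n \near \oo, V (dyadic_floor u t n) by [].
apply: filterS h => n; apply.
by have [/andP[du _] _] := dyadic_floor_itv n ut; rewrite /= in_itv/= du.
Qed.

Section dyadic_chaining.
Variables (R : realType) (u M q : R) (b : nat) (f : R -> R).
Hypotheses (q_gt0 : 0 < q) (q_lt1 : q < 1) (M_ge0 : 0 <= M).
Hypothesis increments : forall n k : nat, (k < b * 2 ^ n)%N ->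
  `|f (u + k.+1%:R / 2 ^+ n) - f (u + k%:R / 2 ^+ n)| <= M * q ^+ n.

Let a t n := f (dyadic_floor u t n).

Let truncn_lt t n : u <= t -> t < u + b%:R ->
  (Num.truncn ((t - u) * 2 ^+ n) < b * 2 ^ n)%N.
Proof.
move=> ut tb; rewrite truncn_lt_nat ?mulr_ge0 ?subr_ge0 ?exprn_ge0//.
by rewrite natrM natrX ltr_pM2r ?exprn_gt0// ltrBlDl.
Qed.

(** The integer part of 2x is 2k or 2k + 1, where k is that of x: refining the grid moves the
    approximation by at most one step of the finer grid. *)
Let dyadic_step t n : u <= t -> t < u + b%:R -> `|a t n.+1 - a t n| <= M * q ^+ n.+1.
Proof.
move=> ut tb; have p0 : 0 < 2 ^+ n :> R by rewrite exprn_gt0.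
have x0 m : 0 <= (t - u) * 2 ^+ m by rewrite mulr_ge0 ?subr_ge0 ?exprn_ge0.
have klt := truncn_lt n ut tb.
have /andP[lo hi] := truncn_itv (x0 n).
rewrite /a /dyadic_floor.
set k := Num.truncn ((t - u) * 2 ^+ n) in klt lo hi *.
set k' := Num.truncn ((t - u) * 2 ^+ n.+1).
have kE : k%:R / 2 ^+ n = (2 * k)%:R / 2 ^+ n.+1 :> R.
  by rewrite exprS natrM; field; rewrite gt_eqF.
have : (2 * k <= k' < 2 * k + 2)%N.
  rewrite /k' truncn_ge_nat// truncn_lt_nat// exprS mulrCA natrD natrM.
  by apply/andP; split; [rewrite ler_pM2l|rewrite -natr1 in hi; nra].
move=> /andP[k1 k2].
have [k'E|k'E] : (k' = 2 * k \/ k' = (2 * k).+1)%N by lia.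
  by rewrite k'E kE subrr normr0 mulr_ge0// exprn_ge0// ltW.
rewrite k'E kE; apply: increments.
rewrite expnS; lia.
Qed.

Let dyadic_tail t n m : u <= t -> t < u + b%:R ->
  `|a t (n + m) - a t n| <= M * q ^+ n * (q / (1 - q)).
Proof.
move=> ut tb.
(* The factor 1 - q^m records the exact partial geometric sum, which closes the induction. *)
suff h : `|a t (n + m) - a t n| <= M * q ^+ n * (q / (1 - q)) * (1 - q ^+ m).
  apply: (le_trans h); apply: ler_piMr; last by rewrite gerBl exprn_ge0// ltW.
  apply: mulr_ge0; first by rewrite mulr_ge0// exprn_ge0// ltW.
  by rewrite divr_ge0 ?subr_ge0 ?ltW.
elim: m => [|m IH]; first by rewrite addn0 !subrr normr0 mulr0.
rewrite addnS.
have -> : a t (n + m).+1 - a t n = (a t (n + m).+1 - a t (n + m)) + (a t (n + m) - a t n).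
  by ring.
rewrite (le_trans (ler_normD _ _))// (le_trans (lerD (dyadic_step _ ut tb) IH))//.
rewrite le_eqVlt; apply/orP; left; apply/eqP.
by rewrite !exprS exprD; field; rewrite subr_eq0 gt_eqF.
Qed.

Lemma is_cvg_dyadic_floor t : u <= t -> t < u + b%:R -> cvg (a t n @[n --> \oo]).
Proof.
move=> ut tb; apply/cauchy_cvgP/cauchy_exP => e e0.
have : M * q ^+ n * (q / (1 - q)) @[n --> \oo] --> M * 0 * (q / (1 - q)).
  apply: cvgM; last exact: cvg_cst.
  apply: cvgM; first exact: cvg_cst.
  by apply: cvg_expr; rewrite gtr0_norm.
rewrite mulr0 mul0r => /cvgrPdist_lt /(_ e e0) [n _ h].
exists (a t n); exists n => // k /= nk; rewrite /ball/= distrC -(subnKC nk).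
apply: (le_lt_trans (dyadic_tail n (k - n) ut tb)).
have := h n (leqnn n); rewrite /= sub0r normrN; apply: le_lt_trans.
exact: ler_norm.
Qed.

Let lim_dist t n : u <= t -> t < u + b%:R ->
  `|lim (a t m @[m --> \oo]) - a t n| <= M * q ^+ n * (q / (1 - q)).
Proof.
move=> ut tb; have cv := is_cvg_dyadic_floor ut tb.
have : `|a t m - a t n| @[m --> \oo] --> `|lim (a t m @[m --> \oo]) - a t n|.
  by apply: cvg_norm; apply: cvgB => //; exact: cvg_cst.
move/cvgr_to_le; apply; exists n => // m /= nm.
by rewrite -(subnKC nm); exact: dyadic_tail.
Qed.

Let dyadic_dist s t n (j : nat) : u <= s -> s <= t -> t < u + b%:R ->
  (Num.truncn ((t - u) * 2 ^+ n) <= Num.truncn ((s - u) * 2 ^+ n) + j)%N ->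
  `|a t n - a s n| <= j%:R * (M * q ^+ n).
Proof.
move=> us st tb; rewrite /a /dyadic_floor.
have ut := le_trans us st.
have kb := truncn_lt n ut tb.
have : (Num.truncn ((s - u) * 2 ^+ n) <= Num.truncn ((t - u) * 2 ^+ n))%N.
  by apply: le_truncn; rewrite ler_pM2r ?exprn_gt0// lerB.
set k := Num.truncn ((t - u) * _) in kb *; set l := Num.truncn _.
have Mq : 0 <= M * q ^+ n by rewrite mulr_ge0// exprn_ge0// ltW.
move=> lk /= kj; apply: (@le_trans _ _ ((k - l)%:R * (M * q ^+ n))); last first.
  by rewrite ler_wpM2r// ler_nat leq_subLR.
move: (k - l)%N (subnKC lk) => i; move: kb => /[swap] <- {lk kj k}.
elim: i => [|i IH] ib; first by rewrite addn0 subrr normr0 mul0r.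
rewrite addnS in ib *; have {IH} := IH (ltnW ib).
have := increments (ltnW ib).
set x := f _; set y := f (u + (l + i)%:R / _); set z := f _ => h1 h2.
rewrite (_ : x - z = (x - y) + (y - z)); last by ring.
by rewrite (le_trans (ler_normD _ _))// -natr1 mulrDl mul1r addrC lerD.
Qed.

(** Two points whose floors at level n are j steps apart have limits within M q^n (j + 2 q / (1 -
    q)). For t - s <= 1 a level with j = 1 serves, otherwise level 0 with j = b; the term b + 1
    covers both. The division by q is the price of knowing only q^(n+1) <= (t - s)^gamma. *)
Lemma lim_dyadic_floor_holder (gamma : R) : 2^-1 `^ gamma = q -> 0 < gamma ->
  forall s t, u <= s -> s < u + b%:R -> u <= t -> t < u + b%:R ->
  `|lim (a t n @[n --> \oo]) - lim (a s n @[n --> \oo])| <=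
  (b%:R + 1 + 2 * (q / (1 - q))) / q * M * `|t - s| `^ gamma.
Proof.
move=> qE gamma0 s t.
set K := b%:R + 1 + 2 * (q / (1 - q)).
have r0 : 0 <= q / (1 - q) by rewrite divr_ge0 ?subr_ge0 ?ltW.
have b0 : 0 <= b%:R :> R by rewrite ler0n.
have K0 : 0 <= K by rewrite /K; lra.
wlog st : s t / s <= t.
  move=> hw us sb ut tb; have [st|/ltW ts] := leP s t; first exact: hw.
  by rewrite distrC [`|t - s|]distrC; exact: hw.
move=> us sb ut tb; move: st; rewrite le_eqVlt => /predU1P[<-|st].
  by rewrite !subrr normr0 mulr_ge0 ?powR_ge0// mulr_ge0// divr_ge0// ltW.
have d0 : 0 < t - s by rewrite subr_gt0.
rewrite (gtr0_norm d0).
have step n j : (Num.truncn ((t - u) * 2 ^+ n) <= Num.truncn ((s - u) * 2 ^+ n) + j)%N ->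
    `|lim (a t n @[n --> \oo]) - lim (a s n @[n --> \oo])| <=
    M * q ^+ n * (j%:R + 2 * (q / (1 - q))).
  move=> h; have := dyadic_dist us (ltW st) tb h.
  have := lim_dist n ut tb; have := lim_dist n us sb.
  set x := lim _; set y := lim _ => h1 h2 h3.
  rewrite (_ : y - x = (y - a t n) + (a t n - a s n) + (a s n - x)); last by ring.
  rewrite (le_trans (ler_normD _ _))//.
  have := ler_normD (y - a t n) (a t n - a s n).
  rewrite [`|a s n - x|]distrC; lra.
have [d1|d1] := leP (t - s) 1.
  have [n /andP[n1 n2]] : exists n, (2^-1 : R) ^+ n.+1 < t - s <= 2^-1 ^+ n.
    have ex : exists n, (2^-1 : R) ^+ n.+1 < t - s.
      move/cvgrPdist_lt : (@cvg_expr_half R) => /(_ _ d0) [n _ h]; exists n.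
      have := h n.+1 (leqnSn n); rewrite /= sub0r normrN; apply: le_lt_trans.
      exact: ler_norm.
    (* The least such n gives the upper bound by minimality; for n = 0 that bound is t - s <= 1. *)
    case: (ex_minnP ex) => n n1 nmin; exists n; rewrite n1/=.
    case: n n1 nmin => [|n] n1 nmin; first by rewrite expr0.
    by rewrite leNgt; apply/negP => /nmin; rewrite ltnn.
  have := step n 1%N; rewrite addn1 => /(_ _)/le_trans; apply.
    rewrite -ltnS truncn_lt_nat ?mulr_ge0 ?subr_ge0 ?exprn_ge0//.
    have x0 : 0 <= (s - u) * 2 ^+ n by rewrite mulr_ge0 ?subr_ge0 ?exprn_ge0.
    have /andP[_ hi] := truncn_itv x0.
    have : (t - s) * 2 ^+ n <= 1 by rewrite -ler_pdivlMr ?exprn_gt0// div1r -exprVn.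
    rewrite -natr1; lra.
  have qd : q ^+ n.+1 <= (t - s) `^ gamma.
    rewrite -qE -powR_mulrn ?powR_ge0// -powRrM mulrC powRrM powR_mulrn ?invr_ge0//.
    by rewrite ge0_ler_powR ?nnegrE ?exprn_ge0 ?invr_ge0 ?ltW.
  rewrite (@le_trans _ _ (K / q * M * q ^+ n.+1))//; last first.
    by rewrite ler_wpM2l// mulr_ge0// divr_ge0// ltW.
  rewrite exprS (_ : K / q * M * (q * q ^+ n) = M * q ^+ n * K); last by field; rewrite gt_eqF.
  by rewrite ler_wpM2l ?mulr_ge0 ?exprn_ge0 ?(ltW q_gt0)//; rewrite /K; lra.
have := step 0%N b; rewrite expr0 !mulr1 => /(_ _)/le_trans; apply.
  apply: (leq_trans (ltnW _)); last exact: leq_addl.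
  by rewrite truncn_lt_nat ?subr_ge0// ltrBlDl.
rewrite (@le_trans _ _ (M * K))//; first by rewrite ler_wpM2l// /K; lra.
have d1' : 1 <= (t - s) `^ gamma.
  have <- : 1 `^ gamma = 1 :> R by rewrite powR1.
  by rewrite ge0_ler_powR ?nnegrE ?ltW.
have q1' : 1 <= q^-1 by rewrite invf_ge1// ltW.
rewrite (_ : K / q * M * _ = M * K * (q^-1 * (t - s) `^ gamma)); last by ring.
by rewrite ler_peMr ?mulr_ge0// mulr_ege1.
Qed.

End dyadic_chaining.

(** * The Kolmogorov criterion *)

Definition excess (R : realType) (c x : R) : R := Num.max 0 (`|x| / c - 1).

Lemma excess_ge0 (R : realType) (c x : R) : 0 <= excess c x.
Proof. by rewrite /excess le_max lexx. Qed.

Lemma excess0 (R : realType) (c : R) : excess c 0 = 0.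
Proof. by rewrite /excess normr0 mul0r sub0r max_l// oppr_le0. Qed.

Lemma le_excess (R : realType) (c x : R) : 0 < c -> `|x| <= (1 + excess c x) * c.
Proof.
by move=> c0; rewrite -ler_pdivrMr// -lerBlDl /excess le_max lexx orbT.
Qed.

(** Where the excess is positive the ratio |x| / c is above 1, and there it is below each of its
    powers. This is how moments of every order enter. *)
Lemma excess_le_exp (R : realType) (p : nat) (c x : R) : (0 < p)%N -> 0 < c ->
  excess c x <= (`|x| / c) ^+ p.
Proof.
move=> p0 c0; have y0 : 0 <= `|x| / c by rewrite divr_ge0// ltW.
rewrite /excess ge_max exprn_ge0//=.
have [y1|y1] := leP 1 (`|x| / c).
  by rewrite (@le_trans _ _ (`|x| / c))// ?gerBl// ler_eXnr.
by rewrite (@le_trans _ _ 0) ?exprn_ge0// subr_le0 ltW.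
Qed.

Lemma measurable_excess d (T : measurableType d) (R : realType) (c : R) (f : T -> R) :
  measurable_fun setT f -> measurable_fun setT (fun w => excess c (f w)).
Proof.
move=> mf; apply: measurable_maxr => //; apply: measurable_funB => //.
by apply: measurable_funM => //; exact: measurableT_comp.
Qed.

(** Integrating term by term bounds the integral of the sum by 2 A, and an integrable function is
    almost everywhere finite. *)
Lemma ae_lty_series d (T : measurableType d) (R : realType) (P : probability T R)
    (F : nat -> T -> \bar R) (A : R) : 0 <= A ->
  (forall n, measurable_fun setT (F n)) -> (forall n w, (0 <= F n w)%E) ->
  (forall n, (\int[P]_w F n w <= (A * 2^-1 ^+ n)%:E)%E) ->
  {ae P, forall w, (\sum_(n <oo) F n w < +oo)%E}.
Proof.
move=> A0 mF F0 leF.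
have mS : measurable_fun setT (fun w => (\sum_(n <oo) F n w)%E).
  by apply: ge0_emeasurable_sum => // n _; exact: mF.
have S0 w : (0 <= \sum_(n <oo) F n w)%E by apply: nneseries_ge0.
have iS : P.-integrable setT (fun w => (\sum_(n <oo) F n w)%E).
  apply/integrableP; split => //.
  under eq_integral do rewrite gee0_abs//.
  rewrite integral_nneseries//; apply: (@le_lt_trans _ _ (2 * A)%:E); last by rewrite ltry.
  have /cvg_lim := @cvg_geometric_eseries_half R (2 * A) 0.
  rewrite expr0 divr1 => <- //.
  apply: lee_nneseries => n _; first by move=> _; exact: integral_ge0.
  apply: (le_trans (leF n)); rewrite lee_fin addn1 natrX exprVn exprS.
  by rewrite le_eqVlt; apply/orP; left; apply/eqP; field; rewrite expf_neq0.
have [N [mN N0 subN]] := integrable_ae measurableT iS.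
exists N; split => //; apply: subset_trans subN => w /= h1 h2; apply: h1.
by rewrite -ge0_fin_numE//; exact: h2.
Qed.

Lemma powR_half_gt0_lt1 (R : realType) (gamma : R) : 0 < gamma ->
  0 < (2^-1 `^ gamma : R) < 1.
Proof.
move=> gamma0; rewrite powR_gt0 ?invr_gt0//=.
rewrite /powR invr_eq0 pnatr_eq0/= -[ltRHS]expR0 ltr_expR.
rewrite pmulr_rlt0//; apply: ln_lt0.
by apply/andP; split; lra.
Qed.

(** The summand 1 matches |x| <= (1 + excess c x) c, so that a finite value can serve directly as
    the constant M of the chaining on [u, u + b]. *)
Definition path_excess (R : realType) (u q : R) (b : nat) (f : R -> R) : \bar R :=
  (1 + \sum_(n <oo) \sum_(k < b * 2 ^ n)
    (excess (q ^+ n) (f (u + k.+1%:R / 2 ^+ n) - f (u + k%:R / 2 ^+ n)))%:E)%E.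

Lemma path_excess_ge1 (R : realType) (u q : R) (b : nat) (f : R -> R) :
  (1 <= path_excess u q b f)%E.
Proof.
rewrite /path_excess leeDl// nneseries_ge0// => n _ _; apply: sume_ge0 => k _.
by rewrite lee_fin excess_ge0.
Qed.

Lemma path_excess_increments (R : realType) (u q : R) (b : nat) (f : R -> R) :
  0 < q -> path_excess u q b f \is a fin_num -> forall n k : nat, (k < b * 2 ^ n)%N ->
  `|f (u + k.+1%:R / 2 ^+ n) - f (u + k%:R / 2 ^+ n)| <=
  fine (path_excess u q b f) * q ^+ n.
Proof.
move=> q0 fin n k kn; have qn0 : 0 < q ^+ n by rewrite exprn_gt0.
rewrite (le_trans (le_excess _ qn0))// ler_wpM2r ?(ltW qn0)//.
rewrite -lee_fin fineK// EFinD leeD2l//.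
pose F (m : nat) := (\sum_(k < b * 2 ^ m)
    (excess (q ^+ m) (f (u + k.+1%:R / 2 ^+ m) - f (u + k%:R / 2 ^+ m)))%:E)%E.
have F0 m : (0 <= F m)%E by apply: sume_ge0 => i _; rewrite lee_fin excess_ge0.
apply: (@le_trans _ _ (F n)); last first.
  apply: (le_trans _ (nneseries_lim_ge n.+1 _)); last by move=> m _ _; exact: F0.
  rewrite big_nat_recr//= leeDr//; apply: sume_ge0 => i _; exact: F0.
rewrite /F. rewrite (bigD1 (Ordinal kn))//= leeDl// sume_ge0// => i _.
by rewrite lee_fin excess_ge0.
Qed.

Lemma measurable_path_excess d (T : measurableType d) (R : realType) (u q : R) (b : nat)
    (X : R -> T -> R) : (forall t, u <= t -> measurable_fun setT (X t)) ->
  measurable_fun setT (fun w => path_excess u q b (X ^~ w)).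
Proof.
move=> mX; apply: emeasurable_funD => //; apply: ge0_emeasurable_sum => [n w _ _|n _].
  by apply: sume_ge0 => i _; rewrite lee_fin excess_ge0.
apply: emeasurable_sum => k; apply/measurable_EFinP; apply: measurable_excess.
by apply: measurable_funB; apply: mX; rewrite lerDl divr_ge0// exprn_ge0.
Qed.

(* Moment bounds of all orders, in a form that conditional expectations inherit
   through the sets [X > c] alone. *)
Definition kolmogorov_bound d (T : measurableType d) (R : realType)
    (P : probability T R) (u H : R) (X : R -> T -> R) : Prop :=
  forall p : nat, (0 < p)%N -> exists2 C : R, 0 <= C & forall s t c : R,
    u <= s -> s < t -> 0 < c ->
    (\int[P]_w (excess c (X t w - X s w))%:E <= (C * ((t - s) `^ H / c) ^+ p)%:E)%E.

Section kolmogorov.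
Variables (d : measure_display) (T : measurableType d) (R : realType).
Variables (P : probability T R) (u H : R) (X : R -> T -> R).
Hypothesis mX : forall t, u <= t -> measurable_fun setT (X t).
Hypothesis kX : kolmogorov_bound P u H X.
Hypothesis H_gt0 : 0 < H.
Variables (gamma : R) (gammaH : gamma < H).

Let q : R := 2^-1 `^ gamma.

Let q_gt0 : 0 < q. Proof. by rewrite powR_gt0 ?invr_gt0. Qed.

Let geometric_bound : exists2 C : R, 0 <= C & forall n s t,
  u <= s -> s < t -> t - s <= 2^-1 ^+ n ->
  (\int[P]_w (excess (q ^+ n) (X t w - X s w))%:E <= (C * (4^-1) ^+ n)%:E)%E.
Proof.
pose theta : R := 2^-1 `^ (H - gamma).
have /andP[theta0 theta1] : 0 < theta < 1.
  by apply: powR_half_gt0_lt1; rewrite subr_gt0.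
(* Level n has b 2^n increments, so a bound of order 4^-n for each still leaves the summable 2^-n.
   The ratio of 2^(-n H) to the threshold q^n is theta^n with theta < 1, and a large moment p brings
   theta^p below 1/4. *)
have [p p0 thetap] : exists2 p : nat, (0 < p)%N & theta ^+ p <= 4^-1.
  have : theta ^+ n @[n --> \oo] --> 0 by apply: cvg_expr; rewrite gtr0_norm.
  have e0 : 0 < 4^-1 :> R by rewrite invr_gt0.
  move/cvgrPdist_le => /(_ _ e0) [n _ h]; exists n.+1 => //.
  by have := h n.+1 (leqnSn n); rewrite /= sub0r normrN gtr0_norm// exprn_gt0.
have [C C0 hC] := kX p0; exists C => // n s t us st tsn.
apply: (le_trans (hC s t (q ^+ n) us st (exprn_gt0 n q_gt0))).
rewrite lee_fin ler_wpM2l// (@le_trans _ _ ((theta ^+ n) ^+ p))//; last first.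
  by rewrite exprAC lerXn2r ?nnegrE ?exprn_ge0 ?invr_ge0// ltW.
apply: lerXn2r.
- by rewrite nnegrE divr_ge0 ?powR_ge0// exprn_ge0// ltW.
- by rewrite nnegrE exprn_ge0// ltW.
rewrite ler_pdivrMr ?exprn_gt0// -exprMn /q /theta -powRD; last first.
  by rewrite invr_eq0 pnatr_eq0 implybT.
rewrite subrK -powR_mulrn ?powR_ge0// powRAC powR_mulrn ?invr_ge0//.
by rewrite ge0_ler_powR ?nnegrE ?exprn_ge0 ?invr_ge0 ?subr_ge0// ltW.
Qed.

Lemma ae_path_excess_lty (b : nat) :
  {ae P, forall w, (path_excess u q b (X ^~ w)) \is a fin_num}.
Proof.
have [C C0 hC] := geometric_bound.
have mD n (k : nat) : measurable_fun setT (fun w =>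
    (excess (q ^+ n) (X (u + k.+1%:R / 2 ^+ n) w - X (u + k%:R / 2 ^+ n) w))%:E).
  apply/measurable_EFinP; apply: measurable_excess.
  by apply: measurable_funB; apply: mX; rewrite lerDl divr_ge0// exprn_ge0.
have bC0 : 0 <= b%:R * C by rewrite mulr_ge0.
have F0 n (k : nat) w :
  (0 <= (excess (q ^+ n) (X (u + k.+1%:R / 2 ^+ n) w - X (u + k%:R / 2 ^+ n) w))%:E)%E.
  by rewrite lee_fin excess_ge0.
pose F n w := (\sum_(k < b * 2 ^ n)
    (excess (q ^+ n) (X (u + k.+1%:R / 2 ^+ n) w - X (u + k%:R / 2 ^+ n) w))%:E)%E.
have aeF : {ae P, forall w, (\sum_(n <oo) F n w < +oo)%E}.
  apply: (ae_lty_series bC0).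
  - by move=> n; apply: emeasurable_sum => k.
  - by move=> n w; apply: sume_ge0.
  - move=> n; rewrite ge0_integral_sum//.
    apply: (@le_trans _ _ (\sum_(k < b * 2 ^ n) (C * 4^-1 ^+ n)%:E)%E).
      apply: lee_sum => k _; apply: hC.
      + by rewrite lerDl divr_ge0// exprn_ge0.
      + by rewrite ltrD2l ltr_pM2r ?invr_gt0 ?exprn_gt0// ltr_nat.
      + by rewrite opprD addrACA subrr add0r -mulrBl -natr1 addrAC subrr add0r div1r exprVn.
    rewrite sumEFin lee_fin sumr_const card_ord.
    rewrite le_eqVlt; apply/orP; left; apply/eqP.
    rewrite -[LHS]mulr_natl natrM natrX (_ : 4^-1 = 2^-1 * 2^-1 :> R); last by field.
    by rewrite exprMn !exprVn; field; rewrite expf_neq0.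
apply: filterS aeF => w h; rewrite /path_excess fin_numD/= ge0_fin_numE//.
by apply: nneseries_ge0 => n _ _; apply: sume_ge0.
Qed.

Hypothesis gamma_gt0 : 0 < gamma.

Let q_lt1 : q < 1. Proof. by have /andP[] := powR_half_gt0_lt1 gamma_gt0. Qed.

(** The null set depends on t. This is what makes the limit along dyadic times a modification of
    X. *)
Lemma ae_cvg_dyadic_floor (t : R) : u <= t ->
  {ae P, forall w, X (dyadic_floor u t n) w @[n --> \oo] --> X t w}.
Proof.
move=> ut; have [C C0 hC] := geometric_bound.
pose F n w := (excess (q ^+ n) (X t w - X (dyadic_floor u t n) w))%:E.
have F0 n w : (0 <= F n w)%E by rewrite lee_fin excess_ge0.
have aeF : {ae P, forall w, (\sum_(n <oo) F n w < +oo)%E}.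
  apply: (ae_lty_series C0) => // n.
    apply/measurable_EFinP; apply: measurable_excess.
    apply: measurable_funB; apply: mX => //.
    by have [/andP[]] := dyadic_floor_itv n ut.
  have [/andP[ud dt] tdn] := dyadic_floor_itv n ut.
  move: dt; rewrite le_eqVlt => /predU1P[dt|dt].
    under eq_integral do rewrite /F dt subrr excess0.
    by rewrite integral0 lee_fin mulr_ge0// exprn_ge0// invr_ge0.
  apply: (le_trans (hC n _ _ ud dt tdn)).
  by rewrite lee_fin ler_wpM2l// lerXn2r ?nnegrE ?invr_ge0//; lra.
apply: filterS aeF => w Fw.
set S := (\sum_(n <oo) F n w)%E in Fw.
have Sfin : S \is a fin_num by rewrite ge0_fin_numE//; exact: nneseries_ge0.
have FS n : excess (q ^+ n) (X t w - X (dyadic_floor u t n) w) <= fine S.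
  rewrite -lee_fin fineK//; apply: (le_trans _ (nneseries_lim_ge n.+1 _)).
    by rewrite big_nat_recr//= leeDr//; apply: sume_ge0.
  by move=> m _ _; exact: F0.
apply/cvgrPdist_le => e e0.
have : (1 + fine S) * q ^+ n @[n --> \oo] --> (1 + fine S) * 0.
  by apply: cvgM; [exact: cvg_cst|apply: cvg_expr; rewrite gtr0_norm].
rewrite mulr0 => /cvgrPdist_le /(_ e e0); apply: filterS => n.
rewrite sub0r normrN => /(le_trans (ler_norm _)); apply: le_trans.
have qn0 : 0 < q ^+ n by rewrite exprn_gt0.
by rewrite (le_trans (le_excess _ qn0))// ler_wpM2r ?(ltW qn0)// lerD2l.
Qed.

End kolmogorov.

(** * Hölder paths and continuous versions *)

Lemma locally_holder_within_continuous (R : realType) (u gamma : R) (g : R -> R) :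
  0 < gamma ->
  (forall b : nat, exists2 K : R, 0 <= K & forall s t, u <= s -> s < u + b%:R ->
     u <= t -> t < u + b%:R -> `|g t - g s| <= K * `|t - s| `^ gamma) ->
  {within `[u, +oo[, continuous g}.
Proof.
move=> gamma0 hg; apply/subspace_continuousP => x.
rewrite /= in_itv/= andbT => ux.
(* One more than needed to pass x: all points within distance 1 of x stay below u + b. *)
pose b := (Num.truncn (x - u)).+2.
have xb : x + 1 <= u + b%:R.
  by have := truncnS_gt (x - u); rewrite /b -[in u + _]natr1; lra.
have [K K0 hK] := hg b.
apply/cvgrPdist_le => e e0.
(* Dividing by K + 1 instead of K also covers K = 0. *)
have K1 : 0 < K + 1 by lra.
pose dl := (e / (K + 1)) `^ gamma^-1.
have dl0 : 0 < dl by rewrite powR_gt0 ?divr_gt0.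
have m0 : 0 < Num.min dl 1 by rewrite lt_min dl0/=.
rewrite near_withinE; exists (Num.min dl 1) => //= y; rewrite /ball/= lt_min => /andP[y1 y2].
rewrite in_itv/= andbT => uy; rewrite distrC.
have yb : y < u + b%:R by move: y2; rewrite ltr_norml => /andP[]; lra.
apply: (le_trans (hK _ _ ux _ uy yb)); first lra.
have : `|y - x| `^ gamma <= e / (K + 1).
  rewrite (_ : e / (K + 1) = dl `^ gamma); last first.
    by rewrite -powRrM mulVf ?gt_eqF// powRr1// divr_ge0// ltW.
  apply: ge0_ler_powR; [exact: ltW|by rewrite nnegrE|by rewrite nnegrE ltW|by rewrite distrC ltW].
move/(ler_wpM2l K0) => /le_trans; apply.
by rewrite mulrCA ler_piMr ?(ltW e0)// ler_pdivrMr// mul1r lerDl.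
Qed.

(** Candidate for the continuous version. It carries information only where the limit exists, which
    a finite [path_excess] guarantees. *)
Definition dyadic_lim (R : realType) (u : R) (f : R -> R) (t : R) : R :=
  lim (f (dyadic_floor u t n) @[n --> \oo]).

(** The factor in front of M in [lim_dyadic_floor_holder]. *)
Definition excess_constant (R : realType) (gamma : R) (b : nat) : R :=
  let q := 2^-1 `^ gamma in (b%:R + 1 + 2 * (q / (1 - q))) / q.

Section dyadic_lim_paths.
Variables (R : realType) (u gamma : R) (b : nat) (f : R -> R).
Hypothesis gamma_gt0 : 0 < gamma.
Let q : R := 2^-1 `^ gamma.

Lemma excess_constant_gt0 : 0 < excess_constant gamma b :> R.
Proof.
have /andP[q0 q1] := powR_half_gt0_lt1 gamma_gt0; rewrite divr_gt0// -/q.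
have : 0 <= q / (1 - q) by rewrite divr_ge0 ?subr_ge0 ?ltW.
have : 0 <= b%:R :> R by [].
lra.
Qed.

Hypothesis fin : path_excess u q b f \is a fin_num.

Let excess0 : 0 <= fine (path_excess u q b f).
Proof. by apply: fine_ge0; exact: le_trans (path_excess_ge1 _ _ _ _). Qed.

Lemma path_excess_is_cvg (t : R) : u <= t -> t < u + b%:R ->
  cvg (f (dyadic_floor u t n) @[n --> \oo]).
Proof.
have /andP[q0 q1] := powR_half_gt0_lt1 gamma_gt0.
exact: is_cvg_dyadic_floor q0 q1 excess0 (path_excess_increments q0 fin) t.
Qed.

Lemma path_excess_holder (s t : R) : u <= s -> s < u + b%:R -> u <= t -> t < u + b%:R ->
  `|dyadic_lim u f t - dyadic_lim u f s| <=
  excess_constant gamma b * fine (path_excess u q b f) * `|t - s| `^ gamma.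
Proof.
have /andP[q0 q1] := powR_half_gt0_lt1 gamma_gt0.
have := lim_dyadic_floor_holder q0 q1 excess0 (path_excess_increments q0 fin) erefl gamma_gt0.
exact.
Qed.

End dyadic_lim_paths.

Lemma path_excess_holder_process d (T : measurableType d) (R : realType)
    (P : probability T R) (u gamma : R) (X : R -> T -> R) : 0 < gamma ->
  (forall t, u <= t -> measurable_fun setT (X t)) ->
  (forall b : nat, {ae P, forall w,
     path_excess u (2^-1 `^ gamma) b (X ^~ w) \is a fin_num}) ->
  {ae P, forall w, {within `[u, +oo[, continuous (X ^~ w)}} ->
  holder_process P `[u, +oo[ X gamma.
Proof.
move=> gamma0 mX exX [N [mN N0 subN]] c c0.
pose b := (Num.truncn (c - u)).+1.
have cb : c < u + b%:R by have := truncnS_gt (c - u); rewrite -/b; lra.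
pose K : R := excess_constant gamma b.
have K0 : 0 < K by exact: excess_constant_gt0.
pose E w := path_excess u (2^-1 `^ gamma) b (X ^~ w).
have E1 w : (1 <= E w)%E by exact: path_excess_ge1.
(* The bound must hold for every w, so the constant is +oo on a measurable null set N containing the
   discontinuous paths. Off N the path equals its own dyadic limit, and [E w] is finite or makes the
   bound trivial. *)
exists (fun w => K%:E * E w + +oo * (\1_N w)%:E)%E; split.
- apply: emeasurable_funD; apply: measurable_funeM.
    exact: measurable_path_excess.
  exact/measurable_EFinP/measurable_indic.
- have aeN : {ae P, forall w, ~ N w} by exists N; split => // w /= /contrapT.
  apply: filterS2 aeN (exX b) => w Nw Ew.
  by rewrite indicE memNset// mule0 adde0 fin_numM.
- move=> w s t; rewrite /= !in_itv/= !andbT => us ut sc tc.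
  have p0 : 0 <= `|t - s| `^ gamma by rewrite powR_ge0.
  have ooP : (`|X t w - X s w|%:E <= +oo * (`|t - s| `^ gamma)%:E)%E.
    (* At t = s the right-hand side is +oo * 0 = 0, which is enough as the left-hand side vanishes
       too. *)
    have [->|ts] := eqVneq t s; first by rewrite !subrr normr0 powR0 ?mule0// gt_eqF.
    by rewrite gt0_mulye ?leey// lte_fin powR_gt0// normr_gt0 subr_eq0.
  have E0 : (0 <= K%:E * E w)%E.
    by rewrite mule_ge0 ?lee_fin ?(ltW K0)//; exact: le_trans (E1 w).
  have [Nw|Nw] := pselect (N w).
    rewrite indicE mem_set// mule1 addey//.
    by rewrite -ltNye; exact: lt_le_trans E0.
  rewrite indicE memNset// mule0 adde0.
  have [Efin|] := boolP (E w \is a fin_num); last first.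
    rewrite ge0_fin_numE; last exact: le_trans (E1 w).
    by rewrite -leNgt leye_eq => /eqP ->; rewrite gt0_muley.
  have cw : {within `[u, +oo[, continuous (X ^~ w)}.
    by apply/not_notP => h; apply: Nw; exact: subN.
  have XE r : u <= r -> X r w = dyadic_lim u (X ^~ w) r.
    by move=> ur; apply/esym/cvg_lim => //; exact: (cvg_dyadic_floor cw ur).
  rewrite -(fineK Efin) -!EFinM lee_fin !XE//.
  by apply: path_excess_holder => //; [exact: le_lt_trans cb|exact: le_lt_trans cb].
Qed.

Section kolmogorov_paths.
Variables (d : measure_display) (T : measurableType d) (R : realType).
Variables (P : probability T R) (u H : R) (X : R -> T -> R).
Hypothesis H_gt0 : 0 < H.
Hypothesis mX : forall t, u <= t -> measurable_fun setT (X t).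
Hypothesis kX : kolmogorov_bound P u H X.

Lemma kolmogorov_continuous_modification :
  exists Y, continuous_modification P `[u, +oo[ X Y.
Proof.
pose gamma := H / 2.
have gamma0 : 0 < gamma by rewrite divr_gt0.
have gammaH : gamma < H by rewrite /gamma ltr_pdivrMr// ltr_pMr// ltr1n.
pose E b w := path_excess u (2^-1 `^ gamma) b (X ^~ w).
have mE b : measurable_fun setT (E b) by exact: measurable_path_excess.
pose G := \bigcap_b (E b @^-1` [set x | x \is a fin_num]).
have mG : measurable G.
  apply: bigcapT_measurable => b; rewrite -[X in measurable X]setTI.
  exact: emeasurable_fin_num.
have aeG : {ae P, forall w, G w}.
  have : {ae P, forall w, forall b, E b w \is a fin_num}.
    by apply: ae_foralln => b; exact: (ae_path_excess_lty mX kX H_gt0 gammaH b).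
  by apply: filterS => w Ew b _; exact: Ew.
(* Cutting X off outside the measurable event G makes the dyadic values converge for every w, so the
   limit is measurable and all its paths are continuous. *)
pose X' t w := X t w * \1_G w.
have X'G w : G w -> X' ^~ w = X ^~ w.
  by move=> Gw; apply/funext => t; rewrite /X' indicE mem_set// mulr1.
have X'NG w : ~ G w -> X' ^~ w = cst 0.
  by move=> Gw; apply/funext => t; rewrite /X' indicE memNset// mulr0.
have bnd (t : R) : u <= t -> exists b : nat, t < u + b%:R.
  move=> ut; exists (Num.truncn (t - u)).+1.
  by have := truncnS_gt (t - u); lra.
have cvgX' t w : u <= t ->
    X' (dyadic_floor u t n) w @[n --> \oo] --> dyadic_lim u (X' ^~ w) t.
  move=> ut; have [Gw|Gw] := pselect (G w).
    have [b tb] := bnd t ut.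
    have XE n : X' (dyadic_floor u t n) w = X (dyadic_floor u t n) w.
      by have /(congr1 (@^~ (dyadic_floor u t n))) := X'G w Gw.
    rewrite (X'G w Gw) (eq_cvg _ _ XE).
    exact: (path_excess_is_cvg gamma0 (Gw b I) ut tb).
  have XE n : X' (dyadic_floor u t n) w = 0.
    by have /(congr1 (@^~ (dyadic_floor u t n))) := X'NG w Gw.
  rewrite (X'NG w Gw) (eq_cvg _ _ XE) /dyadic_lim lim_cst//; exact: cvg_cst.
exists (fun t w => dyadic_lim u (X' ^~ w) t); split.
- move=> t; rewrite /= in_itv/= andbT => ut.
  apply: (@measurable_fun_cvg _ _ _ _ (fun n w => X' (dyadic_floor u t n) w)).
    move=> n; apply: measurable_funM => //.
    by apply: mX; have [/andP[]] := dyadic_floor_itv n ut.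
  by move=> w _; exact: cvgX'.
- move=> t; rewrite /= in_itv/= andbT => ut.
  apply: filterS2 aeG (ae_cvg_dyadic_floor mX kX H_gt0 gammaH gamma0 ut) => w Gw Xw.
  by rewrite (X'G w Gw) /dyadic_lim; exact: cvg_lim Xw.
- apply: aeW => w; have [Gw|Gw] := pselect (G w).
    rewrite (X'G w Gw); apply: (locally_holder_within_continuous gamma0) => b.
    exists (excess_constant gamma b * fine (path_excess u (2^-1 `^ gamma) b (X ^~ w))).
      rewrite mulr_ge0 ?(ltW (excess_constant_gt0 _ _))// fine_ge0//.
      exact: le_trans (path_excess_ge1 _ _ _ _).
    by move=> s t us sb ut tb; apply: path_excess_holder => //; exact: Gw.
  rewrite (X'NG w Gw); apply: continuous_subspaceT => x.
  have -> : dyadic_lim u (cst 0) = cst (0 : R) by apply/funext => t; exact: lim_cst.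
  exact: cvg_cst.
Qed.

Lemma kolmogorov_holder_process (gamma : R) : 0 < gamma -> gamma < H ->
  {ae P, forall w, {within `[u, +oo[, continuous (X ^~ w)}} ->
  holder_process P `[u, +oo[ X gamma.
Proof.
move=> gamma0 gammaH; apply: path_excess_holder_process => // b.
exact: (ae_path_excess_lty mX kX H_gt0 gammaH b).
Qed.

End kolmogorov_paths.

(** * Conditional expectations *)

Lemma fBm_kolmogorov_bound d (T : measurableType d) (R : realType) (P : probability T R)
    (H u : R) (B : R -> {RV P >-> R}) : 0 < H -> is_fBm H B -> 0 <= u ->
  kolmogorov_bound P u H (fun t => B t : T -> R).
Proof.
move=> H0 fB u0 p p0; exists (unit_normal_moment R p); first exact: unit_normal_moment_ge0.
move=> s t c us st c0; have s0 := le_trans u0 us.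
have mD : measurable_fun setT (fun w => B t w - B s w) by exact: measurable_funB.
have mDp : measurable_fun setT (fun w => (`|B t w - B s w| ^+ p)%:E).
  by apply/measurable_EFinP/measurable_funX; exact: measurableT_comp.
apply: (@le_trans _ _ (\int[P]_w ((c ^+ p)^-1%:E * (`|B t w - B s w| ^+ p)%:E))%E).
  apply: ge0_le_integral => //.
  - by move=> w _; rewrite lee_fin excess_ge0.
  - by apply/measurable_EFinP; exact: measurable_excess.
  - exact: measurable_funeM.
  - move=> w _; rewrite -EFinM lee_fin (le_trans (excess_le_exp _ p0 c0))//.
    by rewrite exprMn exprVn mulrC.
rewrite ge0_integralZl_EFin//; last by rewrite invr_ge0 exprn_ge0// ltW.
rewrite (fBm_increment_moment H0 fB p s0 st) -EFinM lee_fin exprMn exprVn.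
by rewrite mulrC mulrA.
Qed.

Section conditional_expectation.
Variables (d : measure_display) (T : measurableType d) (R : realType).
Variables (P : probability T R).

Lemma cond_expectationN (G : set (set T)) (X Z : T -> R) :
  (forall A, G A -> measurable A) -> P.-integrable setT (EFin \o X) ->
  is_cond_expectation P G X Z ->
  is_cond_expectation P G (fun w => - X w) (fun w => - Z w).
Proof.
move=> mG iX [ZG iZ ZX]; split.
- move=> A mA; rewrite (_ : _ @^-1` A = Z @^-1` (-%R @^-1` A)); last by [].
  by apply: ZG; rewrite -[X in measurable X]setTI; exact: oppr_measurable.
- by apply: eq_integrable (integrableN iZ).
- move=> A GA; have mA := mG _ GA.
  have iXA : P.-integrable A (EFin \o X) by exact: integrableS iX.
  have iZA : P.-integrable A (EFin \o Z) by exact: integrableS iZ.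
  under eq_integral do rewrite -[- Z _]mulN1r EFinM.
  under [RHS]eq_integral do rewrite -[- X _]mulN1r EFinM.
  by rewrite !integralZl// ZX.
Qed.

(** The generated form of the sigma-algebra turns it into a measurable type, on which Z1 - Z2 is
    measurable as a difference. *)
Lemma cond_expectationB (S : set (set T)) (X1 X2 Z1 Z2 : T -> R) :
  (forall A, <<s S >> A -> measurable A) ->
  P.-integrable setT (EFin \o X1) -> P.-integrable setT (EFin \o X2) ->
  is_cond_expectation P <<s S >> X1 Z1 -> is_cond_expectation P <<s S >> X2 Z2 ->
  is_cond_expectation P <<s S >> (fun w => X1 w - X2 w) (fun w => Z1 w - Z2 w).
Proof.
move=> mG i1 i2 [G1 iZ1 E1] [G2 iZ2 E2]; split.
- have m1 : measurable_fun [set: g_sigma_algebraType S] Z1.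
    by move=> _ A mA; rewrite setTI; exact: G1.
  have m2 : measurable_fun [set: g_sigma_algebraType S] Z2.
    by move=> _ A mA; rewrite setTI; exact: G2.
  by move=> A mA; have := measurable_funB m1 m2 measurableT mA; rewrite setTI.
- by apply: eq_integrable (integrableB measurableT iZ1 iZ2).
- move=> A GA; have mA := mG _ GA.
  have iA f : P.-integrable setT (EFin \o f) -> P.-integrable A (EFin \o f).
    by move=> i; exact: integrableS i.
  under eq_integral do rewrite EFinB.
  under [RHS]eq_integral do rewrite EFinB.
  by rewrite !integralB_EFin ?E1 ?E2//; exact: iA.
Qed.

(** Jensen for (x - c)^+: with A the event Z > c, which lies in G, E (Z - c)^+ = E [Z - c; A] = E
    [X - c; A] <= E (X - c)^+. *)
Let integral_posB_le (G : set (set T)) (X Z : T -> R) (c : R) :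
  (forall A, G A -> measurable A) -> P.-integrable setT (EFin \o X) ->
  is_cond_expectation P G X Z ->
  (\int[P]_w (Num.max 0 (Z w - c))%:E <= \int[P]_w (Num.max 0 (X w - c))%:E)%E.
Proof.
move=> mG iX [ZG iZ ZX].
have mX : measurable_fun setT X by apply/measurable_EFinP; exact: measurable_int iX.
pose A := Z @^-1` `]c, +oo[.
have GA : G A by apply: ZG; exact: measurable_itv.
have mA := mG _ GA.
have iA f : P.-integrable setT (EFin \o f) -> P.-integrable A (EFin \o f).
  by move=> i; exact: integrableS i.
have ic : P.-integrable A (EFin \o cst c) by exact: finite_measure_integrable_cst.
have mpos : measurable_fun setT (fun w => (Num.max 0 (X w - c))%:E).
  by apply/measurable_EFinP; apply: measurable_maxr => //; exact: measurable_funB.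
apply: (@le_trans _ _ (\int[P]_(w in A) (Z w - c)%:E)%E).
  rewrite [leRHS]integral_mkcond le_eqVlt; apply/orP; left; apply/eqP.
  apply: eq_integral => w _; rewrite patchE.
  have [|] := boolP (w \in A).
    by rewrite inE /A/= in_itv/= andbT => cZ; rewrite max_r// subr_ge0 ltW.
  rewrite notin_setE /A/= in_itv/= andbT => /negP; rewrite -leNgt => Zc.
  by rewrite max_l// subr_le0.
under eq_integral do rewrite EFinB.
rewrite integralB_EFin//; last exact: iA.
rewrite ZX// -integralB_EFin//; last exact: iA.
apply: (@le_trans _ _ (\int[P]_(w in A) (Num.max 0 (X w - c))%:E)%E).
  apply: le_integral => //.
  - have iXc := integrableB mA (iA _ iX) ic.
    by apply: eq_integrable iXc => // w _; rewrite /= EFinB.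
  - have iXc := integrableB mA (iA _ iX) ic.
    apply: le_integrable iXc => //; first exact: measurable_funS mpos.
    move=> w _ /=; rewrite lee_fin ger0_norm ?le_max ?lexx//.
    by rewrite ge_max normr_ge0 ler_norm.
  - by move=> w _; rewrite lee_fin le_max lexx orbT.
apply: ge0_subset_integral => //.
by move=> w _; rewrite lee_fin le_max lexx.
Qed.

Lemma integral_excess_cond_expectation (G : set (set T)) (X Z : T -> R) (c : R) :
  (forall A, G A -> measurable A) -> P.-integrable setT (EFin \o X) ->
  is_cond_expectation P G X Z -> 0 < c ->
  (\int[P]_w (excess c (Z w))%:E <= \int[P]_w (excess c (X w))%:E)%E.
Proof.
move=> mG iX ZX c0.
have [_ iZ _] := ZX.
(* The two tails are treated separately, the lower one as the upper tail of - X and - Z. *)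
have excessE (x : R) : excess c x =
    c^-1 * (Num.max 0 (x - c) + Num.max 0 (- x - c)).
  rewrite /excess; have [x0|x0] := leP 0 x.
    rewrite ger0_norm// [Num.max 0 (- x - c)]max_l ?addr0; last by lra.
    by rewrite maxr_pMr ?invr_ge0 ?(ltW c0)// mulr0 mulrBr mulVf ?gt_eqF// mulrC.
  rewrite ltr0_norm// [Num.max 0 (x - c)]max_l ?add0r; last by lra.
  by rewrite maxr_pMr ?invr_ge0 ?(ltW c0)// mulr0 mulrBr mulVf ?gt_eqF// mulrC.
have mpos (f : T -> R) : P.-integrable setT (EFin \o f) ->
    measurable_fun setT (fun w => (Num.max 0 (f w - c))%:E).
  move=> /(measurable_int P)/measurable_EFinP mf.
  by apply/measurable_EFinP; apply: measurable_maxr => //; exact: measurable_funB.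
have pos0 (f : T -> R) w : (0 <= (Num.max 0 (f w - c))%:E)%E.
  by rewrite lee_fin le_max lexx.
have iN (f : T -> R) : P.-integrable setT (EFin \o f) ->
    P.-integrable setT (EFin \o (fun w => - f w)).
  by move=> i; apply: eq_integrable (integrableN i).
have splitE (f : T -> R) : P.-integrable setT (EFin \o f) ->
    (\int[P]_w (excess c (f w))%:E = c^-1%:E *
      (\int[P]_w (Num.max 0 (f w - c))%:E + \int[P]_w (Num.max 0 (- f w - c))%:E))%E.
  move=> i; under eq_integral do rewrite excessE EFinM EFinD.
  rewrite ge0_integralZl_EFin//; last 3 first.
  - by move=> w _; rewrite adde_ge0// lee_fin le_max lexx.
  - by apply: emeasurable_funD; [exact: mpos|exact: (mpos _ (iN _ i))].
  - by rewrite invr_ge0 ltW.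
  rewrite ge0_integralD//; [exact: mpos| |exact: (mpos _ (iN _ i))].
  by move=> w _; rewrite lee_fin le_max lexx.
rewrite !splitE// lee_wpmul2l ?lee_fin ?invr_ge0 ?(ltW c0)//.
apply: leeD; first exact: integral_posB_le ZX.
exact: (integral_posB_le _ mG (iN _ iX) (cond_expectationN mG iX ZX)).
Qed.

Lemma kolmogorov_bound_cond_expectation (S : set (set T)) (u H : R) (X Z : R -> T -> R) :
  (forall A, <<s S >> A -> measurable A) ->
  (forall t, u <= t -> P.-integrable setT (EFin \o X t)) ->
  (forall t, u <= t -> is_cond_expectation P <<s S >> (X t) (Z t)) ->
  kolmogorov_bound P u H X -> kolmogorov_bound P u H Z.
Proof.
move=> mG iX ZX kX p p0; have [C C0 hC] := kX p p0; exists C => // s t c us st c0.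
have ut := le_trans us (ltW st).
apply: (le_trans _ (hC s t c us st c0)).
apply: (integral_excess_cond_expectation mG) => //.
  by apply: eq_integrable (integrableB measurableT (iX _ ut) (iX _ us)).
by apply: cond_expectationB => //; [exact: iX|exact: iX|exact: ZX|exact: ZX].
Qed.

Lemma kolmogorov_bound_modification (u H : R) (X Y : R -> T -> R) :
  (forall t, u <= t -> measurable_fun setT (X t)) ->
  (forall t, u <= t -> measurable_fun setT (Y t)) ->
  modification P `[u, +oo[ X Y -> kolmogorov_bound P u H X -> kolmogorov_bound P u H Y.
Proof.
move=> mX mY XY kX p p0; have [C C0 hC] := kX p p0; exists C => // s t c us st c0.
have ut := le_trans us (ltW st).
have uP r : u <= r -> `[u, +oo[%classic r by rewrite /= in_itv/= andbT.
apply: (le_trans _ (hC s t c us st c0)).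
rewrite le_eqVlt; apply/orP; left; apply/eqP.
have mE (V : R -> T -> R) : (forall t, u <= t -> measurable_fun setT (V t)) ->
    measurable_fun setT (fun w => (excess c (V t w - V s w))%:E).
  move=> mV; apply/measurable_EFinP; apply: measurable_excess.
  by apply: measurable_funB; exact: mV.
apply: ae_eq_integral => //; [exact: mE|exact: mE|].
by apply: filterS2 (XY _ (uP _ ut)) (XY _ (uP _ us)) => w -> -> _.
Qed.

End conditional_expectation.

(** * Failure of higher regularity *)

(** The density never exceeds its peak; this quantifies the absence of an atom at 0. *)
Lemma normal_prob_itv_le (R : realType) (s x : R) : 0 < s -> 0 <= x ->
  (normal_prob 0 s `[(- x)%R, x] <= (normal_peak s * (2 * x))%:E)%E.
Proof.
move=> s0 x0; have sN0 : s != 0 by rewrite gt_eqF.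
apply: (@le_trans _ _ (\int[lebesgue_measure]_(y in `[(- x)%R, x]) (normal_peak s)%:E)%E).
  apply: ge0_le_integral => //.
  - by move=> y _; rewrite lee_fin normal_pdf_ge0.
  - by apply/measurable_EFinP/measurable_funTS; exact: measurable_normal_pdf.
  - by move=> y _; rewrite lee_fin normal_pdf_ub.
rewrite integral_cst// [X in (_ * X)%E]lebesgue_measure_itv/= lte_fin.
case: ifPn => [_|]; first by rewrite opprK -mulr2n mulr_natl.
by rewrite mule0 lee_fin !mulr_ge0// normal_peak_ge0.
Qed.

(** Integer constants and the times u + 2^-n make this a countable, hence measurable, condition, and
    every path that is Hölder near u satisfies it. *)
Definition dyadically_holder_at (R : realType) (u gamma : R) (f : R -> R) : Prop :=
  exists K : nat, forall n : nat,
    `|f (u + 2^-1 ^+ n) - f u| <= K%:R * (2^-1 ^+ n) `^ gamma.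

Lemma measurable_dyadically_holder_at d (T : measurableType d) (R : realType)
    (u gamma : R) (X : R -> T -> R) :
  (forall t, u <= t -> measurable_fun setT (X t)) ->
  measurable [set w | dyadically_holder_at u gamma (X ^~ w)].
Proof.
move=> mX.
have -> : [set w | dyadically_holder_at u gamma (X ^~ w)] =
    \bigcup_(K in [set: nat]) \bigcap_(n in [set: nat])
    [set w | `|X (u + 2^-1 ^+ n) w - X u w| <= K%:R * (2^-1 ^+ n) `^ gamma].
  apply/seteqP; split => w /=.
    by move=> [K hK]; exists K => // n _; exact: hK.
  by move=> [K _ hK]; exists K => n; exact: hK.
apply: bigcupT_measurable => K; apply: bigcapT_measurable => n.
have mf : measurable_fun setT (fun w => `|X (u + 2^-1 ^+ n) w - X u w|).
  apply: measurableT_comp => //; apply: measurable_funB; apply: mX => //.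
  by rewrite lerDl exprn_ge0// invr_ge0.
rewrite (_ : mkset _ = (fun w => `|X (u + 2^-1 ^+ n) w - X u w|) @^-1`
    `]-oo, K%:R * (2^-1 ^+ n) `^ gamma]).
  by rewrite -[X in measurable X]setTI; exact: mf.
by apply/seteqP; split => w /=; rewrite in_itv.
Qed.


(** For a fixed constant K the intersection over n is contained in each single event, and the
    probability of the n-th one tends to 0. *)
Lemma fBm_not_dyadically_holder d (T : measurableType d) (R : realType)
    (P : probability T R) (H u gamma : R) (B : R -> {RV P >-> R}) :
  0 < H -> is_fBm H B -> 0 <= u -> H < gamma ->
  P [set w | dyadically_holder_at u gamma (B ^~ w)] = 0%E.
Proof.
move=> H0 fB u0 Hgamma.
have half0 n : 0 < 2^-1 ^+ n :> R by rewrite exprn_gt0// invr_gt0.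
pose F (K n : nat) := [set w | `|B (u + 2^-1 ^+ n) w - B u w| <= K%:R * (2^-1 ^+ n) `^ gamma].
have mF K n : measurable (F K n).
  have mf : measurable_fun setT (fun w => `|B (u + 2^-1 ^+ n) w - B u w|).
    by apply: measurableT_comp => //; exact: measurable_funB.
  rewrite (_ : F K n = (fun w => `|B (u + 2^-1 ^+ n) w - B u w|) @^-1`
      `]-oo, K%:R * (2^-1 ^+ n) `^ gamma]).
    by rewrite -[X in measurable X]setTI; exact: mf.
  by apply/seteqP; split => w /=; rewrite in_itv.
(* After normalising the increment by h^H with h = 2^-n, the threshold K h^gamma becomes K r^n. *)
pose r : R := 2^-1 `^ (gamma - H).
have rE n : (2^-1 ^+ n) `^ gamma / (2^-1 ^+ n) `^ H = r ^+ n.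
  rewrite -powRB; last by rewrite (gt_eqF (half0 n)) implybT.
  by rewrite -[2^-1 ^+ n]powR_mulrn ?invr_ge0// powRAC powR_mulrn ?powR_ge0.
have PF K n : (P (F K n) <= (normal_peak (unit_normal_sd R) * (2 * (K%:R * r ^+ n)))%:E)%E.
  have us : u < u + 2^-1 ^+ n by rewrite ltrDl.
  have [mL sd0 law] := fBm_increment_law H0 fB u0 us.
  have hE : u + 2^-1 ^+ n - u = 2^-1 ^+ n by rewrite addrAC subrr add0r.
  have hH0 : 0 < (2^-1 ^+ n) `^ H by rewrite powR_gt0.
  apply: le_trans (normal_prob_itv_le sd0 _); last by rewrite mulr_ge0 ?exprn_ge0 ?powR_ge0.
  rewrite -law; last exact: measurable_itv.
  rewrite le_eqVlt; apply/orP; left; apply/eqP; congr (P _).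
  apply/seteqP; split => w; rewrite /F /= in_itv/= -ler_norml hE normrM normfV (gtr0_norm hH0) -rE.
    by rewrite ler_pdivrMr// mulrA divfK// gt_eqF.
  by rewrite ler_pdivrMr// mulrA divfK// gt_eqF.
apply: measure_negligible; first exact: (@measurable_dyadically_holder_at _ _ _ u gamma
    (fun t => B t : T -> R) (fun t _ => measurable_funP (B t))).
have -> : [set w | dyadically_holder_at u gamma (B ^~ w)] =
    \bigcup_K \bigcap_n F K n.
  apply/seteqP; split => w /=.
    by move=> [K hK]; exists K => // n _; exact: hK.
  by move=> [K _ hK]; exists K => n; exact: hK.
apply: negligible_bigcup => K.
have mI : measurable (\bigcap_n F K n) by exact: bigcapT_measurable.
have fin : P (\bigcap_n F K n) \is a fin_num by exact: fin_num_measure.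
have PIF n : fine (P (\bigcap_n F K n)) <=
    normal_peak (unit_normal_sd R) * (2 * (K%:R * r ^+ n)).
  rewrite -lee_fin fineK//; apply: le_trans (PF K n).
  by apply: le_measure; rewrite ?inE//; exact: bigcap_inf.
suff P0 : fine (P (\bigcap_n F K n)) <= 0.
  apply/negligibleP => //; apply/eqP; rewrite eq_le measure_ge0 andbT.
  by apply: (@le_trans _ _ (fine (P (\bigcap_n F K n)))%:E); [rewrite fineK|rewrite lee_fin].
have : normal_peak (unit_normal_sd R) * (2 * (K%:R * r ^+ n)) @[n --> \oo] -->
    normal_peak (unit_normal_sd R) * (2 * (K%:R * 0)).
  apply: cvgM; first exact: cvg_cst.
  apply: cvgM; first exact: cvg_cst.
  apply: cvgM; first exact: cvg_cst.
  apply: cvg_expr.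
  have g0 : 0 < gamma - H by rewrite subr_gt0.
  by have /andP[r0 r1] := powR_half_gt0_lt1 g0; rewrite gtr0_norm.
rewrite !mulr0 => /cvgr_to_ge; apply; apply: nearW => n.
exact: PIF.
Qed.

(** * Correlation with the sign of a past increment *)

Definition sign_gt0 (R : realType) (x : R) : R := if 0 < x then 1 else -1.

(** The sign takes the value -1 at 0, so no point is exceptional. *)
Lemma normr_sign_gt0 (R : realType) (x : R) : `|sign_gt0 x| = 1.
Proof. by rewrite /sign_gt0; case: ifP; rewrite ?normrN normr1. Qed.

Lemma mulr_sign_gt0 (R : realType) (x : R) : sign_gt0 x * x = `|x|.
Proof.
rewrite /sign_gt0; case: (ltP 0 x) => x0; first by rewrite mul1r gtr0_norm.
by rewrite mulN1r ler0_norm.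
Qed.

Lemma measurable_sign_gt0 d (T : measurableType d) (R : realType) (f : T -> R) :
  measurable_fun setT f -> measurable_fun setT (fun w => sign_gt0 (f w)).
Proof.
move=> mf; apply: measurable_fun_ifT => //.
exact: measurable_fun_ltr.
Qed.

Lemma integrable_sign_gt0 d (T : measurableType d) (R : realType) (P : probability T R)
    (f X : T -> R) : measurable_fun setT f -> P.-integrable setT (EFin \o X) ->
  P.-integrable setT (EFin \o (fun w => sign_gt0 (f w) * X w)).
Proof.
move=> mf iX; have mX : measurable_fun setT X.
  by apply/measurable_EFinP; exact: measurable_int iX.
apply: le_integrable iX => //.
  by apply/measurable_EFinP; apply: measurable_funM => //; exact: measurable_sign_gt0.
by move=> w _ /=; rewrite lee_fin normrM normr_sign_gt0 mul1r.
Qed.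

(** Pulling out a known factor is elementary for a sign: the event f > 0 cuts A into two events of
    the sigma-algebra, and on each the factor is constant. *)
Lemma Rintegral_sign_cond_expectation d (T : measurableType d) (R : realType)
    (P : probability T R) (S : set (set T)) (X Z f : T -> R) (A : set T) :
  (forall A, <<s S >> A -> measurable A) -> P.-integrable setT (EFin \o X) ->
  is_cond_expectation P <<s S >> X Z ->
  (forall A : set R, measurable A -> <<s S >> (f @^-1` A)) -> <<s S >> A ->
  (\int[P]_(w in A) (sign_gt0 (f w) * X w) = \int[P]_(w in A) (sign_gt0 (f w) * Z w))%R.
Proof.
move=> mG iX [_ iZ ZX] Gf GA.
have mf : measurable_fun setT f by move=> _ E mE; rewrite setTI; apply: mG; exact: Gf.
pose Q := f @^-1` `]0, +oo[.
have GQ : <<s S >> Q by apply: Gf; exact: measurable_itv.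
have GAQ : <<s S >> (A `&` Q).
  exact: (@measurableI _ (g_sigma_algebraType S) A Q GA GQ).
have GAD : <<s S >> (A `\` Q).
  exact: (@measurableD _ (g_sigma_algebraType S) A Q GA GQ).
have split (Y : T -> R) : P.-integrable setT (EFin \o Y) ->
    (\int[P]_(w in A) (sign_gt0 (f w) * Y w) =
     \int[P]_(w in A `&` Q) Y w - \int[P]_(w in A `\` Q) Y w)%R.
  move=> iY; have mAQ := mG _ GAQ; have mAD := mG _ GAD.
  have iSY := integrable_sign_gt0 mf iY.
  rewrite -[in LHS](setUIDK A Q) Rintegral_setU//; last 2 first.
  - by rewrite setUIDK; apply: integrableS iSY => //; exact: mG.
  - by apply/disj_set2P; rewrite setDE setIACA setICr setI0.
  congr (_ + _).
    apply: eq_Rintegral => w; rewrite inE => -[_]; rewrite /Q/= in_itv/= andbT.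
    by rewrite /sign_gt0 => ->; rewrite mul1r.
  rewrite -mulN1r -RintegralZl//; last exact: integrableS iY.
  apply: eq_Rintegral => w; rewrite inE => -[_]; rewrite /Q/= in_itv/= andbT.
  by rewrite /sign_gt0 => /negP/negbTE ->.
by rewrite !split// /Rintegral !ZX.
Qed.

Lemma fBm_integrable d (T : measurableType d) (R : realType) (P : probability T R)
    (H t : R) (B : R -> {RV P >-> R}) : is_fBm H B -> 0 <= t ->
  P.-integrable setT (EFin \o B t).
Proof. by move=> fB t0; apply: gaussian_rv_integrable; exact: fBm_gaussian_rv fB t0. Qed.

(** Lower bound, per unit of h^H, for rho E [X sign xi]. Regressing X on xi would give the larger
    value m rho^2, with m the first absolute moment; the form here comes from two first absolute
    moments alone. *)
Definition fBm_sign_correlation (R : realType) (H : R) : R :=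
  unit_normal_moment R 1 * (1 - Num.sqrt (1 - fBm_rho H ^+ 2)).

(* [|x + a y| >= |x| + a sign(x) y] with [a = - rho], the value of [a] that
   minimises the variance of the left-hand side. *)
Lemma fBm_sign_correlation_le d (T : measurableType d) (R : realType)
    (P : probability T R) (H u h : R) (B : R -> {RV P >-> R}) :
  0 < H -> H < 1 -> is_fBm H B -> 0 < h -> h <= u ->
  fBm_sign_correlation H * h `^ H <=
  fBm_rho H * (\int[P]_w (sign_gt0 (B u w - B (u - h) w) * (B (u + h) w - B u w)))%R.
Proof.
move=> H0 H1 fB h0 hu.
have rho1 := fBm_rho_lt1 H1; set rho := fBm_rho H in rho1 *.
set xi := fun w => B u w - B (u - h) w; set X := fun w => B (u + h) w - B u w.
have iB t : 0 <= t -> P.-integrable setT (EFin \o B t) by exact: (fBm_integrable fB).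
have ixi : P.-integrable setT (EFin \o xi).
  by apply: eq_integrable (integrableB measurableT (iB u _) (iB (u - h) _)) => //; lra.
have iX : P.-integrable setT (EFin \o X).
  by apply: eq_integrable (integrableB measurableT (iB (u + h) _) (iB u _)) => //; lra.
have mxi : measurable_fun setT xi by exact: measurable_funB.
have isX := integrable_sign_gt0 mxi iX.
have irX (f : T -> R) a : P.-integrable setT (EFin \o f) ->
    P.-integrable setT (EFin \o (fun w => a * f w)).
  by move=> i; apply: eq_integrable (integrableZl measurableT a i).
have iD (f g : T -> R) : P.-integrable setT (EFin \o f) ->
    P.-integrable setT (EFin \o g) -> P.-integrable setT (EFin \o (fun w => f w + g w)).
  by move=> i j; apply: eq_integrable (integrableD measurableT i j).
have E1 : (\int[P]_w `|xi w|)%R = unit_normal_moment R 1 * h `^ H.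
  have u0 : 0 <= u - h by rewrite subr_ge0.
  have uu : u - h < u by rewrite ltrBlDr ltrDl.
  have := fBm_increment_moment H0 fB 1 u0 uu; rewrite subKr expr1 => eq1.
  rewrite /Rintegral -[RHS]/(fine _%:E) -eq1.
  by congr fine; apply: eq_integral => w _; rewrite expr1.
have rho2 : 0 < 1 - rho ^+ 2.
  by rewrite subr_gt0 -real_normK ?num_real// expr_lt1.
have E2 : (\int[P]_w `|xi w + - rho * X w|)%R =
    unit_normal_moment R 1 * (h `^ H * Num.sqrt (1 - rho ^+ 2)).
  have v0 : 1 + 2 * - rho * rho + (- rho) ^+ 2 = 1 - rho ^+ 2 by ring.
  have := @fBm_adjacent_increments_moment _ _ _ P H B H0 fB (- rho) u h h0 hu.
  by rewrite -/rho v0 => /(_ rho2) eq2; rewrite /Rintegral -[RHS]/(fine _%:E) -eq2.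
have : (\int[P]_w (`|xi w| + - rho * (sign_gt0 (xi w) * X w)) <=
        \int[P]_w `|xi w + - rho * X w|)%R.
  apply: le_Rintegral => //.
  - by apply: iD; [exact: integrable_norm|exact: irX].
  - by apply: (integrable_norm (f := fun w => xi w + - rho * X w)); apply: iD => //; exact: irX.
  - move=> w _; rewrite -mulr_sign_gt0 mulrCA -mulrDr.
    by rewrite (le_trans (ler_norm _))// normrM normr_sign_gt0 mul1r.
rewrite RintegralD//; [|exact: integrable_norm|exact: irX].
rewrite RintegralZl// E1 E2 /fBm_sign_correlation -/rho; lra.
Qed.

Lemma fBm_sign_correlation_gt0 d (T : measurableType d) (R : realType)
    (P : probability T R) (H : R) (B : R -> {RV P >-> R}) :
  0 < H -> H < 1 -> H <> 2^-1 -> is_fBm H B -> 0 < fBm_sign_correlation H :> R.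
Proof.
move=> H0 H1 H2 fB.
(* The increment of B over [0, 1] witnesses that [unit_normal_sd] is positive. *)
have [_ sd0 _] := fBm_increment_law H0 fB (lexx 0) ltr01.
rewrite mulr_gt0 ?unit_normal_moment1_gt0// subr_gt0 -[ltRHS]sqrtr1.
have rho0 := fBm_rho_neq0 H2.
by rewrite ltr_sqrt// ltrBlDr ltrDl exprn_even_gt0.
Qed.

(** The events C > n decrease to a null event. *)
Lemma ae_fin_num_tail d (T : measurableType d) (R : realType) (P : probability T R)
    (C : T -> \bar R) (e : R) : 0 < e -> measurable_fun setT C ->
  {ae P, forall w, C w \is a fin_num} ->
  exists K : nat, (P [set w | (K%:R%:E < C w)%E] <= e%:E)%E.
Proof.
move=> e0 mC aeC; pose F (n : nat) := [set w | (n%:R%:E < C w)%E].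
have mF n : measurable (F n).
  by rewrite -[X in measurable X]setTI; exact: emeasurable_fun_o_infty.
have PF0 : P (\bigcap_n F n) = 0%E.
  apply: measure_negligible; first exact: bigcapT_measurable.
  apply: negligibleS aeC => w /= Fw Cw.
  have [c cw] : exists c, C w = c%:E by exists (fine (C w)); rewrite fineK.
  have := Fw (Num.truncn c).+1 I; rewrite /F/= cw lte_fin.
  by rewrite ltNge ltW// truncnS_gt.
have : P (F n) @[n --> \oo] --> P (\bigcap_n F n).
  apply: nonincreasing_cvg_mu => //.
  - by rewrite (le_lt_trans (probability_le1 _ _))// ltry.
  - exact: bigcapT_measurable.
  - move=> n m nm; apply/subsetPset => w; rewrite /F/=.
    by apply: le_lt_trans; rewrite lee_fin ler_nat.
rewrite PF0 => /fine_cvgP[_ /cvgrPdist_le /(_ e e0)[n _ h]]; exists n.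
have := h n (leqnn n); rewrite /= sub0r normrN => Pe.
by rewrite -(fineK (fin_num_measure P _ (mF n))) lee_fin (le_trans (ler_norm _)).
Qed.

(** * The past at time u and the irregularity of the conditional mean *)

Section past.
Variables (d : measure_display) (T : measurableType d) (R : realType).
Variables (P : probability T R) (B : R -> {RV P >-> R}) (u : R).

Lemma past_measurable (A : set T) : past (fun t => B t : T -> R) u A -> measurable A.
Proof.
apply: (@smallest_sub _ _ _ _ (@sigma_algebra_measurable _ T)) => _ [v _ [E mE <-]].
exact: measurable_funP.
Qed.

Lemma past_preimage (v : R) (E : set R) : 0 <= v -> v <= u -> measurable E ->
  past (fun t => B t : T -> R) u (B v @^-1` E).
Proof.
move=> v0 vu mE; apply: sub_sigma_algebra; exists v; first by rewrite /= in_itv/= v0.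
by exists E => //; rewrite setTI.
Qed.

Lemma past_preimageB (v w : R) (E : set R) : 0 <= v -> v <= u -> 0 <= w -> w <= u ->
  measurable E -> past (fun t => B t : T -> R) u ((fun x => B v x - B w x) @^-1` E).
Proof.
move=> v0 vu w0 wu mE.
set S := \bigcup_(v in `[0, u]) preimage_set_system setT (B v : T -> R) measurable.
have mB r : 0 <= r -> r <= u -> measurable_fun [set: g_sigma_algebraType S] (B r : T -> R).
  by move=> r0 ru _ A mA; rewrite setTI; exact: past_preimage.
by have := measurable_funB (mB _ v0 vu) (mB _ w0 wu) measurableT mE; rewrite setTI.
Qed.

End past.

Lemma conditional_mean_not_holder d (T : measurableType d) (R : realType)
    (P : probability T R) (H u gamma : R) (B : R -> {RV P >-> R}) (m Y : R -> T -> R) :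
  0 < H -> H < 1 -> H <> 2^-1 -> is_fBm H B -> 0 < u -> H < gamma ->
  is_conditional_mean P (fun t => B t : T -> R) u m ->
  modification P `[u, +oo[ m Y -> ~ holder_process P `[u, +oo[ Y gamma.
Proof.
move=> H0 H1 H2 fB u0 Hgamma cm mY hY.
have kap0 := fBm_sign_correlation_gt0 H0 H1 H2 fB.
set kap := fBm_sign_correlation H in kap0.
have rho1 := fBm_rho_lt1 H1.
set M2 := unit_normal_moment R 2.
have M20 : 0 <= M2 by exact: unit_normal_moment_ge0.
(* Weight for the Young inequality below: eps X^2 / (2 s) contributes at most kap s / 4, and s / (2
   eps) on an event of probability at most kap eps / 2 contributes at most kap s / 4. Neither
   depends on h, so K is fixed before h is chosen. *)
pose eps := kap / (2 * (M2 + 1)).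
have eps0 : 0 < eps by rewrite divr_gt0// mulr_gt0// ltr_wpDl.
have u1 : 0 < u + 1 by rewrite addr_gt0.
have [C [mC aeC hC]] := hY _ u1.
have del0 : 0 < kap * eps / 2 by rewrite divr_gt0// mulr_gt0.
have [K PK] := ae_fin_num_tail del0 mC aeC.
(* Below eta, K h^gamma is at most kap h^H / 4; this is where gamma > H is used. *)
pose eta := (kap / (4 * (K%:R + 1))) `^ (gamma - H)^-1.
have K1 : 0 < K%:R + 1 :> R by rewrite ltr_wpDl.
have eta0 : 0 < eta by rewrite powR_gt0// divr_gt0// mulr_gt0.
(* h <= u keeps the past increment at nonnegative times, and h <= 1 keeps u + h within the horizon u
   + 1 of the Hölder constant. *)
pose h := Num.min (Num.min u 1) eta.
have h0 : 0 < h by rewrite !lt_min u0 ltr01 eta0.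
have hu : h <= u by rewrite /h !ge_min lexx.
have h1 : h <= 1 by rewrite /h !ge_min lexx orbT.
have heta : h <= eta by rewrite /h !ge_min lexx orbT.
pose s := h `^ H.
have s0 : 0 < s by rewrite powR_gt0.
have hgam : K%:R * h `^ gamma <= s * (kap / 4).
  have -> : h `^ gamma = s * h `^ (gamma - H).
    by rewrite /s -powRD ?(gt_eqF h0) ?implybT// addrC subrK.
  rewrite mulrCA ler_wpM2l ?(ltW s0)//.
  have g0 : 0 < gamma - H by rewrite subr_gt0.
  have : h `^ (gamma - H) <= kap / (4 * (K%:R + 1)).
    apply: (@le_trans _ _ (eta `^ (gamma - H))).
      by apply: ge0_ler_powR; rewrite ?nnegrE// ltW.
    by rewrite /eta -powRrM mulVf ?gt_eqF// powRr1// ltW// divr_gt0// mulr_gt0.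
  move=> /(ler_wpM2l (ler0n _ K)) /le_trans; apply.
  rewrite [leLHS](_ : _ = (kap / 4) * (K%:R / (K%:R + 1))); last by field; rewrite gt_eqF.
  by rewrite ler_piMr ?divr_ge0 ?(ltW kap0)// ler_pdivrMr// mul1r lerDl.
set G := past (fun t => B t : T -> R) u.
have mG A : G A -> measurable A by exact: past_measurable.
have uh : u <= u + h by rewrite lerDl ltW.
set xi := fun w => B u w - B (u - h) w; set X := fun w => B (u + h) w - B u w.
set Z := fun w => m (u + h) w - m u w.
have iB t : 0 <= t -> P.-integrable setT (EFin \o B t) by exact: (fBm_integrable fB).
have iX : P.-integrable setT (EFin \o X).
  by apply: eq_integrable (integrableB measurableT (iB (u + h) _) (iB u _)) => //; lra.
have ZX : is_cond_expectation P G X Z.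
  apply: cond_expectationB => //.
  - by apply: iB; lra.
  - by apply: iB; lra.
  - exact: cm.
  - exact: cm.
have [GZ iZ _] := ZX.
have mxi : measurable_fun setT xi by exact: measurable_funB.
have Gxi (A : set R) : measurable A -> G (xi @^-1` A).
  by move=> mA; apply: past_preimageB => //; lra.
(* Defined through the mean m rather than its modification Y, so that A is an event of the past; the
   Hölder bound for Y then holds on A up to null sets. *)
pose A := Z @^-1` `[- (K%:R * h `^ gamma), K%:R * h `^ gamma].
have GA : G A by apply: GZ; exact: measurable_itv.
have mA := mG _ GA; have mCA : measurable (~` A) by exact: measurableC.
have PCA : (P (~` A) <= (kap * eps / 2)%:E)%E.
  apply: le_trans PK.
  have uP r : u <= r -> `[u, +oo[%classic r by rewrite /= in_itv/= andbT.
  have [N1 [mN1 N10 sub1]] := mY _ (uP _ uh).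
  have [N2 [mN2 N20 sub2]] := mY _ (uP _ (lexx u)).
  have mF : measurable [set w | (K%:R%:E < C w)%E].
    by rewrite -[X in measurable X]setTI; exact: emeasurable_fun_o_infty.
  have mN12 : measurable (N1 `|` N2) by exact: measurableU.
  have N120 : P (N1 `|` N2) = 0%E.
    by apply: measure_negligible => //; apply: negligibleU; apply/negligibleP.
  apply: (@le_trans _ _ (P ([set w | (K%:R%:E < C w)%E] `|` (N1 `|` N2)))).
    apply: le_measure; rewrite ?inE//; first exact: measurableU.
    move=> w nA; have [Nw|Nw] := pselect ((N1 `|` N2) w); [by right|left => /=].
    rewrite ltNge; apply/negP => CK; apply: nA.
    have Yh : Y (u + h) w = m (u + h) w.
      by apply/not_notP => ne; apply: Nw; left; exact: sub1.
    have Yu : Y u w = m u w.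
      by apply/not_notP => ne; apply: Nw; right; exact: sub2.
    rewrite /A/= in_itv/= -ler_norml /Z -Yh -Yu -lee_fin.
    have ub1 : u <= u + 1 by rewrite lerDl.
    have uh1 : u + h <= u + 1 by rewrite lerD2l.
    apply: (le_trans (hC w u (u + h) (uP _ (lexx u)) (uP _ uh) ub1 uh1)).
    rewrite addrAC subrr add0r (gtr0_norm h0) EFinM.
    by apply: lee_wpmul2r => //; rewrite lee_fin powR_ge0.
  rewrite (le_trans (measureU2 _ _ _))// [X in (_ + X)%E](_ : _ = 0%E) ?adde0//.
have isX := integrable_sign_gt0 mxi iX.
have isZ := integrable_sign_gt0 mxi iZ.
have part1 : `|\int[P]_(w in A) (sign_gt0 (xi w) * X w)|%R <= s * (kap / 4).
  (* On A, an event of the past, X may be replaced by Z, which is small there. *)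
  rewrite (Rintegral_sign_cond_expectation mG iX ZX Gxi GA).
  apply: (le_trans (le_normr_Rintegral mA (integrableS measurableT mA _ isZ))) => //.
  apply: le_trans hgam.
  apply: (@le_trans _ _ (\int[P]_(w in A) (K%:R * h `^ gamma))%R).
    apply: le_Rintegral => //.
    - by apply: (integrable_norm (f := fun w => sign_gt0 (xi w) * Z w)); exact: integrableS isZ.
    - exact: finite_measure_integrable_cst.
    - move=> w; rewrite /A/= in_itv/= -ler_norml.
      by rewrite normrM normr_sign_gt0 mul1r.
  rewrite Rintegral_cst// ler_piMr ?mulr_ge0 ?powR_ge0//.
  by rewrite -lee_fin fineK ?fin_num_measure// probability_le1.
have part2 : `|\int[P]_(w in ~` A) (sign_gt0 (xi w) * X w)|%R <= s * (kap / 2).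
  apply: (le_trans (le_normr_Rintegral mCA (integrableS measurableT mCA _ isX))) => //.
  have us : u < u + h by rewrite ltrDl.
  have hE : u + h - u = h by rewrite addrAC subrr add0r.
  have := fBm_increment_moment H0 fB 2 (ltW u0) us; rewrite hE -/s -/M2 => X2E.
  have iX2 : P.-integrable setT (EFin \o (fun w => X w ^+ 2)).
    apply/integrableP; split.
      by apply/measurable_EFinP/measurable_funX; exact: measurable_funB.
    under eq_integral do rewrite /= ger0_norm ?sqr_ge0// -real_normK ?num_real//.
    by rewrite X2E ltry.
  have E2 : (\int[P]_w (X w ^+ 2))%R = M2 * s ^+ 2.
    rewrite /Rintegral -[RHS]/(fine _%:E) -X2E; congr fine; apply: eq_integral => w _.
    by rewrite -real_normK ?num_real.
  have iCA (f : T -> R) : P.-integrable setT (EFin \o f) -> P.-integrable (~` A) (EFin \o f).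
    by move=> i; exact: integrableS i.
  have ic : P.-integrable (~` A) (EFin \o (fun=> s / (2 * eps))).
    exact: finite_measure_integrable_cst.
  have iaX2 : P.-integrable (~` A) (EFin \o (fun w => eps / (2 * s) * X w ^+ 2)).
    by apply: eq_integrable (integrableZl mCA (eps / (2 * s)) (iCA _ iX2)).
  (* AM-GM: [|x| <= eps x^2 / (2 s) + s / (2 eps)]. *)
  apply: (@le_trans _ _ (\int[P]_(w in ~` A) (eps / (2 * s) * X w ^+ 2 + s / (2 * eps)))%R).
    apply: le_Rintegral => //.
    - by apply: (integrable_norm (f := fun w => sign_gt0 (xi w) * X w)); exact: iCA.
    - by apply: eq_integrable (integrableD mCA iaX2 ic).
    - move=> w _; rewrite normrM normr_sign_gt0 mul1r -[X w ^+ 2]real_normK ?num_real//.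
      set x := `|X w|; rewrite -subr_ge0.
      rewrite (_ : _ - x = (eps * x - s) ^+ 2 / (2 * s * eps)); last first.
        by field; rewrite !gt_eqF.
      apply: divr_ge0; first exact: sqr_ge0.
      by rewrite ltW// mulr_gt0// mulr_gt0.
  rewrite RintegralD// RintegralZl//; last exact: iCA.
  rewrite Rintegral_cst//.
  have I2 : (\int[P]_(w in ~` A) (X w ^+ 2))%R <= M2 * s ^+ 2.
    rewrite -E2; rewrite /Rintegral fine_le ?integrable_fin_num//; first exact: iCA.
    apply: ge0_subset_integral => //.
    + exact: measurable_int iX2.
    + by move=> w _; rewrite lee_fin sqr_ge0.
  have PA : fine (P (~` A)) <= kap * eps / 2.
    by rewrite -lee_fin fineK ?fin_num_measure.
  have c1 : 0 <= eps / (2 * s) by rewrite ltW// divr_gt0// mulr_gt0.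
  have c2 : 0 <= s / (2 * eps) by rewrite ltW// divr_gt0// mulr_gt0.
  apply: (le_trans (lerD (ler_wpM2l c1 I2) (ler_wpM2l c2 PA))).
  rewrite (_ : _ + _ = s * (kap / 4 * (M2 / (M2 + 1)) + kap / 4)); last first.
    by rewrite /eps; field; rewrite !gt_eqF// ltr_wpDl.
  rewrite ler_wpM2l ?(ltW s0)//.
  have : kap / 4 * (M2 / (M2 + 1)) <= kap / 4.
    by rewrite ler_piMr ?divr_ge0 ?(ltW kap0)// ler_pdivrMr ?ltr_wpDl// mul1r lerDl.
  lra.
have := fBm_sign_correlation_le H0 H1 fB h0 hu; rewrite -/kap -/s -/xi.
rewrite -[X in (\int[P]_(w in X) _)%R](setvU A) setUC.
rewrite Rintegral_setU//; last 2 first.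
- by rewrite setUv.
- by apply/disj_set2P; rewrite setICr.
set I1 := (\int[P]_(w in A) _)%R; set I2 := (\int[P]_(w in ~` A) _)%R => le1.
(* As |rho| < 1, the two parts add up to at most 3/4 of the lower bound kap s. *)
have : fBm_rho H * (I1 + I2) <= s * (kap / 4) + s * (kap / 2).
  apply: (le_trans (ler_norm _)); rewrite normrM.
  apply: (@le_trans _ _ `|I1 + I2|); first by rewrite ler_piMl// ltW.
  by rewrite (le_trans (ler_normD _ _))// lerD.
move/(le_trans le1); rewrite leNgt => /negP; apply.
have : 0 < s * kap by rewrite mulr_gt0.
lra.
Qed.

(** * Hoelder indices *)

Lemma holder_index_eq d (T : measurableType d) (R : realType) (P : probability T R)
    (D : set R) (X : R -> T -> R) (H : R) :
  (forall e, 0 < e -> exists2 gamma, H - e < gamma &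
     0 < gamma /\ holder_process P D X gamma) ->
  (forall gamma, H < gamma -> ~ holder_process P D X gamma) ->
  holder_index P D X = H%:E.
Proof.
move=> lo hi; apply/eqP; rewrite eq_le; apply/andP; split.
  apply: ge_ereal_sup => _ [gamma [gamma0 hgamma] <-]; rewrite lee_fin leNgt.
  by apply/negP => /hi.
apply/lee_addgt0Pr => e e0; have [gamma Hgamma hX] := lo e e0.
apply: (@le_trans _ _ (gamma%:E + e%:E)%E); first by rewrite -EFinD lee_fin; lra.
by rewrite leeD2r//; apply: ereal_sup_ubound; exists gamma.
Qed.

Lemma conditional_mean_holder_index d (T : measurableType d) (R : realType)
    (P : probability T R) (H u : R) (B : R -> {RV P >-> R}) (m : R -> T -> R) :
  0 < H -> H < 1 -> H <> 2^-1 -> is_fBm H B -> 0 < u ->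
  is_conditional_mean P (fun t => B t : T -> R) u m ->
  has_holder_index P `[u, +oo[ m H.
Proof.
move=> H0 H1 H2 fB u0 cm.
have mm t : u <= t -> measurable_fun setT (m t).
  by move=> ut; have [_ im _] := cm t ut; apply/measurable_EFinP; exact: measurable_int im.
have km : kolmogorov_bound P u H m.
  have kB := fBm_kolmogorov_bound H0 fB (ltW u0).
  apply: kolmogorov_bound_cond_expectation kB; last exact: cm.
    exact: past_measurable.
  by move=> t ut; apply: (fBm_integrable fB); exact: le_trans (ltW u0) ut.
split; first exact: kolmogorov_continuous_modification km.
move=> Y [mY YM cY].
have mY' t : u <= t -> measurable_fun setT (Y t).
  by move=> ut; apply: mY; rewrite /= in_itv/= ut.
have kY := kolmogorov_bound_modification mm mY' YM km.
apply: holder_index_eq.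
  (* The maximum with H / 2 keeps the exponent positive for large e. *)
  move=> e e0; exists (Num.max (H / 2) (H - e / 2)).
    by rewrite lt_max; apply/orP; right; lra.
  split; first by rewrite lt_max divr_gt0.
  apply: (kolmogorov_holder_process H0 mY' kY) => //; first by rewrite lt_max divr_gt0.
  by rewrite gt_max; apply/andP; split; lra.
by move=> gamma Hgamma; exact: (conditional_mean_not_holder H0 H1 H2 fB u0 Hgamma cm YM).
Qed.

(** * Transfer to the conditional law on path space *)

Lemma regular_cond_law_null d (T : measurableType d) (R : realType) (P : probability T R)
    (S : set (set T)) d' (E : measurableType d') (Y : T -> E)
    (kappa : T -> probability E R) (A : set E) :
  is_regular_cond_law P <<s S >> Y kappa -> measurable A ->
  measurable (Y @^-1` A) -> P (Y @^-1` A) = 0%E ->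
  {ae P, forall w, kappa w A = 0%E}.
Proof.
move=> kY mA mYA PYA; have [_ iZ ZE] := kY A mA.
have GT : <<s S >> setT by exact: (@measurableT _ (g_sigma_algebraType S)).
(* Tested on the whole space, the nonnegative function [kappa w A] has integral P (Y in A) = 0. *)
have := ZE _ GT; rewrite integral_indic// setIT => I0.
have mZ := measurable_int _ iZ.
have /(ae_eq_integral_abs P measurableT mZ) : (\int[P]_w `|(fine (kappa w A))%:E| = 0)%E.
  rewrite -PYA -I0; apply: eq_integral => w _; rewrite gee0_abs// lee_fin fine_ge0//.
apply: filterS => w /(_ I) /= [fk].
by rewrite -[LHS]fineK ?fin_num_measure// fk.
Qed.

Section path_space.
Variables (R : realType) (u : R).

Lemma measurable_coordinate (t : R) : u <= t ->
  measurable_fun [set: cpath u] (@coordinate R u t).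
Proof.
move=> ut _ A mA; rewrite setTI; apply: sub_sigma_algebra.
exists t; first by rewrite /= in_itv/= ut.
by exists A => //; rewrite setTI.
Qed.

Lemma coordinate_continuous_modification (Q : probability (cpath u) R) :
  continuous_modification Q `[u, +oo[ (@coordinate R u) (@coordinate R u).
Proof.
split.
- by move=> t; rewrite /= in_itv/= andbT; exact: measurable_coordinate.
- by move=> t _; exact: aeW.
- by apply: aeW => f; exact: cpath_continuous.
Qed.

Lemma ae_dyadic_coordinate (Q : probability (cpath u) R) (X : R -> cpath u -> R) :
  modification Q `[u, +oo[ (@coordinate R u) X ->
  {ae Q, forall f, forall n k : nat, X (u + k%:R / 2 ^+ n) f = f (u + k%:R / 2 ^+ n)}.
Proof.
move=> QX; apply: ae_foralln => n; apply: ae_foralln => k; apply: QX.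
by rewrite /= in_itv/= andbT lerDl divr_ge0// exprn_ge0.
Qed.

(** Both hypotheses see a path only at dyadic times, where any modification of the coordinate
    process agrees with it almost surely; they therefore decide the index of all continuous
    modifications together. *)
Lemma path_space_holder_index (Q : probability (cpath u) R) (H : R) : 0 < H ->
  (forall e, 0 < e -> exists2 gamma, H - e < gamma & 0 < gamma /\ forall b : nat,
     {ae Q, forall f : cpath u, path_excess u (2^-1 `^ gamma) b f \is a fin_num}) ->
  (forall gamma, H < gamma ->
     {ae Q, forall f : cpath u, ~ dyadically_holder_at u gamma f}) ->
  has_holder_index Q `[u, +oo[ (@coordinate R u) H.
Proof.
move=> H0 lo hi; split.
  by exists (@coordinate R u); exact: coordinate_continuous_modification.
move=> X [mX QX cX]; have aeX := ae_dyadic_coordinate QX.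
apply: holder_index_eq.
  move=> e e0; have [gamma Hgamma [gamma0 hgamma]] := lo e e0.
  exists gamma => //; split => //; apply: path_excess_holder_process => //.
    by move=> t ut; apply: mX; rewrite /= in_itv/= ut.
  move=> b; apply: filterS2 aeX (hgamma b) => f Xf.
  rewrite (_ : path_excess _ _ _ f = path_excess u (2^-1 `^ gamma) b (X ^~ f))//.
  rewrite /path_excess; congr (_ + _)%E; apply: eq_eseriesr => n _.
  by apply: eq_bigr => k _; rewrite !Xf.
move=> gamma Hgamma hX.
(* [holder_process] asks for a positive horizon, and u may be negative here. *)
have u1 : 0 < Num.max 1 (u + 1) by rewrite lt_max ltr01.
have [C [mC aeC hC]] := hX _ u1.
have aeF : {ae Q, forall f : cpath u, False}.
  apply: filterS3 aeX aeC (hi _ Hgamma) => f Xf Cf; apply.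
  exists (Num.truncn (fine (C f))).+1 => n.
  have hn0 : 0 < 2^-1 ^+ n :> R by rewrite exprn_gt0// invr_gt0.
  have hn1 : 2^-1 ^+ n <= 1 :> R by rewrite exprn_ile1//; lra.
  have e1 : u + 2^-1 ^+ n = u + 1%:R / 2 ^+ n by rewrite div1r exprVn.
  have e0 : u = u + 0%:R / 2 ^+ 0 by rewrite mul0r addr0.
  have us : `[u, +oo[%classic u by rewrite /= in_itv/= lexx.
  have ut : `[u, +oo[%classic (u + 2^-1 ^+ n) by rewrite /= in_itv/= andbT lerDl ltW.
  have ub : u <= Num.max 1 (u + 1) by rewrite le_max lerDl ler01 orbT.
  have tb : u + 2^-1 ^+ n <= Num.max 1 (u + 1) by rewrite le_max lerD2l hn1 orbT.
  have := hC f u (u + 2^-1 ^+ n) us ut ub tb.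
  have -> : X u f = f u by rewrite [in X u]e0 Xf -e0.
  have -> : X (u + 2^-1 ^+ n) f = f (u + 2^-1 ^+ n) by rewrite e1 Xf.
  rewrite addrAC subrr add0r (gtr0_norm hn0) -(fineK Cf) -EFinM lee_fin.
  move=> /le_trans; apply; rewrite ler_wpM2r ?powR_ge0// ltW//.
  exact: truncnS_gt.
have QT : (Q [set: cpath u] > 0)%E by rewrite probability_setT lte01.
by have [] := @filter_ex _ _ (ae_properfilter_algebraOfSetsType QT) _ aeF.
Qed.

End path_space.

Lemma conditional_process_holder_index d (T : measurableType d) (R : realType)
    (P : probability T R) (H u : R) (B : R -> {RV P >-> R})
    (Y : {mfun T >-> cpath u}) (kappa : T -> probability (cpath u) R) :
  0 < H -> is_fBm H B -> 0 < u ->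
  is_conditional_process P (fun t => B t : T -> R) Y kappa ->
  {ae P, forall w, has_holder_index (kappa w) `[u, +oo[ (@coordinate R u) H}.
Proof.
move=> H0 fB u0 [YB kY].
pose X t w := coordinate t (Y w).
have mX t : u <= t -> measurable_fun setT (X t).
  by move=> ut; exact: (measurableT_comp (measurable_coordinate ut)).
have kX : kolmogorov_bound P u H X.
  apply: kolmogorov_bound_modification YB (fBm_kolmogorov_bound H0 fB (ltW u0)) => //.
have mYA (A : set (cpath u)) : measurable A -> measurable (Y @^-1` A).
  by move=> mA; exact: measurable_funPTI.
(* One null set of w must serve all exponents, so countable sequences approach H from both sides; n
   + 2 in the denominator keeps [lo n] positive. *)
pose lo (n : nat) : R := H - H / n.+2%:R.
pose hi (n : nat) : R := H + n.+1%:R^-1.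
have lo_lt n : lo n < H by rewrite /lo ltrBlDr ltrDl divr_gt0.
have hi_gt n : H < hi n by rewrite /hi ltrDl invr_gt0.
have aelo : {ae P, forall w, forall n b : nat, {ae kappa w, forall f : cpath u,
    path_excess u (2^-1 `^ (lo n)) b f \is a fin_num}}.
  apply: ae_foralln => n; apply: ae_foralln => b.
  pose A : set (cpath u) := [set f | path_excess u (2^-1 `^ (lo n)) b f \is a fin_num].
  have mA : measurable A.
    rewrite -[X in measurable X]setTI; apply: emeasurable_fin_num => //.
    apply: (@measurable_path_excess _ _ _ u _ b (@coordinate R u)) => t.
    exact: measurable_coordinate.
  have YA : P (Y @^-1` ~` A) = 0%E.
    apply: measure_negligible; first exact/mYA/measurableC.
    exact: (ae_path_excess_lty mX kX H0 (lo_lt n) b).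
  have := regular_cond_law_null kY (measurableC mA) (mYA _ (measurableC mA)) YA.
  by apply: filterS => w kA; apply/negligibleP => //; exact: measurableC.
have aehi : {ae P, forall w, forall n : nat, {ae kappa w, forall f : cpath u,
    ~ dyadically_holder_at u (hi n) f}}.
  apply: ae_foralln => n.
  pose A : set (cpath u) := [set f : cpath u | dyadically_holder_at u (hi n) f].
  have mA : measurable A.
    apply: (@measurable_dyadically_holder_at _ _ _ u _ (@coordinate R u)) => t.
    exact: measurable_coordinate.
  have YA : P (Y @^-1` A) = 0%E.
    apply: measure_negligible; first exact: mYA.
    have aeB : {ae P, forall w, ~ dyadically_holder_at u (hi n) (B ^~ w)}.
      exists [set w | dyadically_holder_at u (hi n) (B ^~ w)]; split.
      + exact: (@measurable_dyadically_holder_at _ _ _ u (hi n)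
          (fun t => B t : T -> R) (fun t _ => measurable_funP (B t))).
      + exact: fBm_not_dyadically_holder fB (ltW u0) (hi_gt n).
      + by move=> w /=; exact: contrapT.
    have ut j : `[u, +oo[%classic (u + 2^-1 ^+ j).
      by rewrite /= in_itv/= andbT lerDl exprn_ge0// invr_ge0.
    have uu : `[u, +oo[%classic u by rewrite /= in_itv/= lexx.
    have aeYB : {ae P, forall w, forall j : nat, Y w (u + 2^-1 ^+ j) = B (u + 2^-1 ^+ j) w}.
      by apply: ae_foralln => j; exact: YB _ (ut j).
    have aeYA : {ae P, forall w, ~ dyadically_holder_at u (hi n) (Y w)}.
      apply: filterS3 aeB aeYB (YB _ uu) => w Bw Yj Yu [K hK]; apply: Bw.
      by exists K => j; rewrite -Yj -Yu; exact: hK.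
    by apply: negligibleS aeYA => w /= Aw; apply.
  have := regular_cond_law_null kY mA (mYA _ mA) YA.
  by apply: filterS => w kA; exists A; split => // f /=; exact: contrapT.
apply: filterS2 aelo aehi => w klo khi; apply: path_space_holder_index => //.
  move=> e e0; pose n := Num.truncn (H / e); exists (lo n).
    rewrite /lo ltrD2l ltrN2 ltr_pdivrMr// -ltr_pdivrMl// mulrC.
    by rewrite (lt_trans (truncnS_gt _))// ltr_nat.
  split => //; rewrite /lo subr_gt0 ltr_pdivrMr// ltr_pMr// ltr1n//.
move=> gamma Hgamma; pose n := Num.truncn (gamma - H)^-1.
have hn : hi n <= gamma.
  rewrite /hi -lerBrDl -[leRHS]invrK lef_pV2 ?posrE ?invr_gt0 ?subr_gt0//.
  by rewrite ltW// truncnS_gt.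
apply: filterS (khi n) => f hf [K hK]; apply: hf; exists K => j.
(* For steps of length at most 1 a larger exponent is the stronger condition, so failure at [hi n]
   excludes gamma. *)
rewrite (le_trans (hK j))// ler_wpM2l//.
apply: ger_powR => //; rewrite exprn_gt0 ?invr_gt0//= exprn_ile1//; lra.
Qed.

(* For H = 1/2 the conditional mean is constant in t, so its index is not H. *)
Theorem proposition3p4 (R : realType) (d : measure_display)
    (T : measurableType d) (P : probability T R)
    (H : R) (H_gt0 : 0 < H) (H_lt1 : H < 1)
    (B : R -> {RV P >-> R}) (B_fBm : is_fBm H B)
    (u : R) (u_gt0 : 0 < u) :
  (forall (Y : {mfun T >-> cpath u}) (kappa : T -> probability (cpath u) R),
      is_conditional_process P (fun t => B t : T -> R) Y kappa ->
      {ae P, forall w, has_holder_index (kappa w) `[u, +oo[ (@coordinate R u) H})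
  /\
  (H <> 2^-1 ->
   forall m : R -> T -> R,
      is_conditional_mean P (fun t => B t : T -> R) u m ->
      has_holder_index P `[u, +oo[ m H).
Proof.
split; first by move=> Y kappa; exact: conditional_process_holder_index.
by move=> H2 m; exact: conditional_mean_holder_index.
Qed.
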